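(* Let $\sigma_0<0$, let $\mathcal{L}\in\mathcal{S}$ have degree $\mathrm{d}_{\mathcal{L}}$, and assume that $\mathcal{L}(1+\mathrm{i}t)\ll\log^{\ell}|t|$ as $|t|\to\infty$ for some $\ell>0$. Then, for $s=\sigma+\mathrm{i}t$ with $|t|$ sufficiently large, $$\mathcal{L}(s)\ll\begin{cases}|t|^{\mathrm{d}_{\mathcal{L}}\left(\frac12-\sigma\right)}\log^{\ell}|t|, & \sigma_0\le\sigma<0,\\ |t|^{\frac12\mathrm{d}_{\mathcal{L}}(1-\sigma)}\log^{\ell}|t|, & 0\le\sigma\le1,\\ \log^{\ell}|t|, & \sigma>1,\end{cases}$$ where the implied constants are uniform in $\sigma$.
   Context: $\mathcal{S}$ is the Selberg class: Dirichlet series $\mathcal{L}(s)=\sum_{n\ge1}a(n)n^{-s}$ satisfying: (1) $a(n)\ll_{\varepsilon}n^{\varepsilon}$ for every $\varepsilon>0$; (2) there is an integer $k\ge0$ such that $(s-1)^k\mathcal{L}(s)$ is entire of finite order; (3) $\Lambda_{\mathcal{L}}(s)=\omega\overline{\Lambda_{\mathcal{L}}(1-\bar s)}$, where $\Lambda_{\mathcal{L}}(s)=\mathcal{L}(s)Q^s\prod_{j=1}^{f}\Gamma(\lambda_js+\mu_j)$ with $Q,\lambda_j>0$ real, $\mu_j,\omega\in\mathbb{C}$, $\Re\{\mu_j\}\ge0$, $|\omega|=1$; (4) $\mathcal{L}(s)=\prod_p\exp\left(\sum_{k\ge1}b(p^k)p^{-ks}\right)$ with $b(p^k)\ll p^{k\theta}$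 for some $0\le\theta<1/2$. The degree is $\mathrm{d}_{\mathcal{L}}=2\sum_{j=1}^f\lambda_j$ (well defined). Implied constants may depend on $\mathcal{L}$, $\ell$ and $\sigma_0$. *)

(* Defs.v *)
From Stdlib Require Import Reals ZArith Znumtheory List Arith.
From Coquelicot Require Import Coquelicot.
Open Scope R_scope.

Definition Cexp (z : C) : C :=
  (exp (Re z) * cos (Im z), exp (Re z) * sin (Im z)).

(* x^z with the real logarithm; meaningful for x > 0 only. *)
Definition Rcpow (x : R) (z : C) : C := Cexp (z * RtoC (ln x))%C.

Definition Cprod (l : list C) : C := fold_right Cmult (RtoC 1) l.

(* Euler's product limit n! n^z / (z (z+1) ... (z+n)), which converges to
   Gamma(z) at every z that is not a pole; at the poles the value is junk. *)
Definition Gamma_approx (z : C) (n : nat) : C :=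
  (RtoC (INR (fact n)) * Rcpow (INR n) z
   / Cprod (map (fun k => z + RtoC (INR k)) (seq 0 (S n))))%C.

Definition Gamma (z : C) : C :=
  (real (Lim_seq (fun n => Re (Gamma_approx z n))),
   real (Lim_seq (fun n => Im (Gamma_approx z n)))).

Definition Gamma_pole (z : C) : Prop :=
  exists n : nat, z = RtoC (- INR n).

Definition entire (G : C -> C) : Prop :=
  forall s : C, @ex_derive C_AbsRing C_NormedModule G s.

Definition finite_order (G : C -> C) : Prop :=
  exists A r0 : R, 0 < A /\ 0 < r0 /\
    forall s : C, r0 <= Cmod s -> Cmod (G s) <= exp (Rpower (Cmod s) A).

(* The coefficients are indexed from 1; the value a 0 is irrelevant. *)
Definition dirichlet_series_of (a : nat -> C) (L : C -> C) : Prop :=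
  forall s : C, 1 < Re s ->
    @is_series C_AbsRing C_NormedModule
      (fun n => a (S n) * Rcpow (INR (S n)) (- s))%C (L s).

Definition ramanujan_bound (a : nat -> C) : Prop :=
  forall eps : R, 0 < eps ->
    exists K : R, forall n : nat, (1 <= n)%nat ->
      Cmod (a n) <= K * Rpower (INR n) eps.

(* L is a total function whose value at the possible pole s = 1 is irrelevant,
   so the entire function is G, which agrees with (s-1)^k L(s) off s = 1. *)
Definition analytic_continuation (L : C -> C) : Prop :=
  exists (k : nat) (G : C -> C),
    entire G /\ finite_order G /\
    forall s : C, s <> RtoC 1 -> G s = ((s - RtoC 1) ^ k * L s)%C.

(* gf is the list of the pairs (lambda_j, mu_j), j = 1, ..., f. *)
Definition Lambda (L : C -> C) (Q : R) (gf : list (R * C)) (s : C) : C :=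
  (L s * Rcpow Q s
   * Cprod (map (fun lm => Gamma (RtoC (fst lm) * s + snd lm)) gf))%C.

(* An identity of meromorphic functions: it is asserted at every s where all
   the factors of both sides are defined. *)
Definition functional_equation
    (L : C -> C) (Q : R) (omega : C) (gf : list (R * C)) : Prop :=
  0 < Q /\ Cmod omega = 1 /\
  (forall lm : R * C, In lm gf -> 0 < fst lm /\ 0 <= Re (snd lm)) /\
  forall s : C,
    s <> RtoC 0 -> s <> RtoC 1 ->
    (forall lm : R * C, In lm gf ->
       ~ Gamma_pole (RtoC (fst lm) * s + snd lm)%C /\
       ~ Gamma_pole (RtoC (fst lm) * (RtoC 1 - Cconj s) + snd lm)%C) ->
    Lambda L Q gf s = (omega * Cconj (Lambda L Q gf (RtoC 1 - Cconj s)))%C.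

Definition primes_below (N : nat) : list nat :=
  filter (fun n => if prime_dec (Z.of_nat n) then true else false) (seq 0 N).

(* Only the values of b at prime powers matter; E p is the local sum
   \sum_(k >= 1) b(p^k) p^(-ks). *)
Definition euler_product (L : C -> C) : Prop :=
  exists (b : nat -> C) (theta K : R),
    0 <= theta < 1 / 2 /\
    (forall p k : nat, prime (Z.of_nat p) -> (1 <= k)%nat ->
       Cmod (b (p ^ k)%nat) <= K * Rpower (INR p) (INR k * theta)) /\
    forall s : C, 1 < Re s ->
      exists E : nat -> C,
        (forall p : nat, prime (Z.of_nat p) ->
           @is_series C_AbsRing C_NormedModule
             (fun k => b (p ^ S k)%nat
                       * Rcpow (INR p) (- (RtoC (INR (S k)) * s)))%C (E p)) /\
        filterlim (fun N => Cprod (map (fun p => Cexp (E p)) (primes_below N)))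
          eventually (@locally C_NormedModule (L s)).

Definition selberg_class (L : C -> C) : Prop :=
  (exists a : nat -> C, dirichlet_series_of a L /\ ramanujan_bound a) /\
  analytic_continuation L /\
  (exists (Q : R) (omega : C) (gf : list (R * C)),
     functional_equation L Q omega gf) /\
  euler_product L.

(* A relation, since L does not determine Q, the lambda_j and the mu_j. *)
Definition has_degree (L : C -> C) (d : R) : Prop :=
  exists (Q : R) (omega : C) (gf : list (R * C)),
    functional_equation L Q omega gf /\
    d = 2 * fold_right Rplus 0 (map fst gf).

(* Main.v *)
Require Import Defs.
From Stdlib Require Import Reals Lra Lia List Arith ClassicalEpsilon.
From Coquelicot Require Import Coquelicot.
Open Scope R_scope.

(* Let G be the entire function (s-1)^k L(s). Around a point s0 of height tau,
   the maximum principle on a rectangle of height tau is applied to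
     G(s) exp(- cos((s - s0)/2)) tau^(- q (s - s0)).
   The cosine factor decays doubly exponentially along the strip and beats the
   finite order of G on the horizontal sides; the power of tau interpolates
   between the exponents on the two vertical sides; and the logarithms need no
   holomorphic substitute, being comparable to log tau on the whole rectangle.
   On 1 <= Re s <= 3 this gives the case Re s > 1, since L is bounded for
   Re s >= 3. The functional equation carries this to Re s <= 0: its Gamma
   quotients compare Gamma at two points of equal imaginary part y, and
   Gamma(x1 + iy)/Gamma(x2 + iy) << |y|^(x1 - x2) follows factor by factor from
   Euler's limit. The strip 0 <= Re s <= 1 is then interpolated.

   The maximum principle comes from Goursat's theorem, Cauchy's formula on a
   rectangle, and Landau's power trick. *)

(** * Complex differentiability *)

(** While one point s0 is treated, tau is a constant, so tau^(- q (s - s0)) is entire and no branch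
    of log s enters. The price is that the bounds on the sides involve |Im s| instead of tau; on a
    rectangle reaching tau/2 above and below s0 their quotient lies between 1/2 and 3/2, and the
    exchange costs a constant. Halving s - s0 inside the cosine keeps its argument in |Re| <= 1,
    where cos >= 1/2, as long as the strip has width at most 2; the strips [1, 3] and [0, 1] fit.
    The strip [1, 3] is treated separately because absolute convergence gives no bound that stays
    uniform as Re s decreases to 1. The functional equation relates s to 1 - conj s, a point of the
    same height, so the exponential decay of Gamma cancels and only a power of the height survives:
    its exponent is the sum of the shifts lambda_j (1 - 2 Re s), that is d (1/2 - Re s). *)

Definition cont_at (f : C -> C) (z : C) : Prop :=
  forall eps : R, 0 < eps -> exists delta : R, 0 < delta /\
    forall w : C, Cmod (w - z) < delta -> Cmod (f w - f z) < eps.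

(* Caratheodory's form of complex differentiability, for which the product and
   chain rules are algebraic identities. *)
Definition diff_at (f : C -> C) (z : C) : Prop :=
  exists phi : C -> C, cont_at phi z /\
    forall w : C, f w = (f z + phi w * (w - z))%C.

Lemma cont_at_ext_near (f g : C -> C) (z : C) (r : R) :
  0 < r -> (forall w, Cmod (w - z) < r -> f w = g w) ->
  cont_at f z -> cont_at g z.
Proof.
intros Hr E Hf eps Heps.
destruct (Hf eps Heps) as [d [Hd H]].
exists (Rmin d r); split; [now apply Rmin_pos|].
intros w Hw.
assert (H1 := Rmin_l d r). assert (H2 := Rmin_r d r).
rewrite <- (E w), <- (E z).
- apply H; lra.
- replace (z - z)%C with (RtoC 0) by ring. rewrite Cmod_0; lra.
- lra.
Qed.

Lemma cont_at_const (c z : C) : cont_at (fun _ => c) z.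
Proof.
intros eps Heps; exists 1; split; [lra|]; intros w _.
replace (c - c)%C with (RtoC 0) by ring. now rewrite Cmod_0.
Qed.

Lemma cont_at_id (z : C) : cont_at (fun w => w) z.
Proof. intros eps Heps; exists eps; split; auto. Qed.

Lemma cont_at_plus (f g : C -> C) (z : C) :
  cont_at f z -> cont_at g z -> cont_at (fun w => f w + g w)%C z.
Proof.
intros Hf Hg eps Heps.
destruct (Hf (eps / 2)) as [d1 [Hd1 H1]]; [lra|].
destruct (Hg (eps / 2)) as [d2 [Hd2 H2]]; [lra|].
exists (Rmin d1 d2); split; [now apply Rmin_pos|].
intros w Hw.
assert (K1 := Rmin_l d1 d2). assert (K2 := Rmin_r d1 d2).
replace (f w + g w - (f z + g z))%C with ((f w - f z) + (g w - g z))%C by ring.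
eapply Rle_lt_trans; [apply Cmod_triangle|].
specialize (H1 w ltac:(lra)); specialize (H2 w ltac:(lra)); lra.
Qed.

Lemma cont_at_mult (f g : C -> C) (z : C) :
  cont_at f z -> cont_at g z -> cont_at (fun w => f w * g w)%C z.
Proof.
intros Hf Hg eps Heps.
set (A := Cmod (f z) + 1). set (B := Cmod (g z) + 1).
assert (HA : 0 < A) by (unfold A; generalize (Cmod_ge_0 (f z)); lra).
assert (HB : 0 < B) by (unfold B; generalize (Cmod_ge_0 (g z)); lra).
destruct (Hf (Rmin 1 (eps / (2 * B)))) as [d1 [Hd1 H1]].
{ apply Rmin_pos; [lra|]. apply Rdiv_lt_0_compat; lra. }
destruct (Hg (eps / (2 * A))) as [d2 [Hd2 H2]].
{ apply Rdiv_lt_0_compat; lra. }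
exists (Rmin d1 d2); split; [now apply Rmin_pos|].
intros w Hw.
assert (K1 := Rmin_l d1 d2). assert (K2 := Rmin_r d1 d2).
specialize (H1 w ltac:(lra)); specialize (H2 w ltac:(lra)).
assert (L1 := Rmin_l 1 (eps / (2 * B))). assert (L2 := Rmin_r 1 (eps / (2 * B))).
assert (Hfw : Cmod (f w) < A).
{ replace (f w) with ((f w - f z) + f z)%C by ring.
  eapply Rle_lt_trans; [apply Cmod_triangle|]. unfold A; lra. }
replace (f w * g w - f z * g z)%C
  with (f w * (g w - g z) + (f w - f z) * g z)%C by ring.
eapply Rle_lt_trans; [apply Cmod_triangle|]. rewrite !Cmod_mult.
assert (M1 : Cmod (f w) * Cmod (g w - g z) <= A * (eps / (2 * A))).
{ apply Rmult_le_compat; try apply Cmod_ge_0; lra. }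
assert (M2 : Cmod (f w - f z) * Cmod (g z) < (eps / (2 * B)) * B).
{ apply Rle_lt_trans with ((eps / (2 * B)) * Cmod (g z)).
  - apply Rmult_le_compat_r; [apply Cmod_ge_0|lra].
  - apply Rmult_lt_compat_l; [apply Rdiv_lt_0_compat; lra|unfold B; lra]. }
replace (A * (eps / (2 * A))) with (eps / 2) in M1 by (field; lra).
replace (eps / (2 * B) * B) with (eps / 2) in M2 by (field; lra).
lra.
Qed.

Lemma cont_at_comp (f g : C -> C) (z : C) :
  cont_at f z -> cont_at g (f z) -> cont_at (fun w => g (f w)) z.
Proof.
intros Hf Hg eps Heps.
destruct (Hg eps Heps) as [d [Hd H]].
destruct (Hf d Hd) as [d' [Hd' H']].
exists d'; split; auto.
Qed.

Lemma cont_at_inv (z : C) : z <> RtoC 0 -> cont_at Cinv z.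
Proof.
intros Hz eps Heps.
assert (Hm := proj1 (Cmod_gt_0 z) Hz).
set (m := Cmod z) in *.
exists (Rmin (m / 2) (eps * (m * m) / 2)); split.
{ apply Rmin_pos; [lra|]. apply Rdiv_lt_0_compat; [|lra].
  repeat apply Rmult_lt_0_compat; lra. }
intros w Hw.
assert (K1 := Rmin_l (m / 2) (eps * (m * m) / 2)).
assert (K2 := Rmin_r (m / 2) (eps * (m * m) / 2)).
assert (Hwm : m / 2 < Cmod w).
{ assert (T := Cmod_triangle (z - w) w).
  replace (z - w + w)%C with z in T by ring.
  replace (z - w)%C with (- (w - z))%C in T by ring.
  rewrite Cmod_opp in T. fold m in T. lra. }
assert (Hw0 : w <> RtoC 0).
{ intros E; rewrite E, Cmod_0 in Hwm; lra. }
replace (/ w - / z)%C with (- (w - z) * (/ w * / z))%C by (field; auto).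
rewrite !Cmod_mult, Cmod_opp, !Cmod_inv by auto. fold m.
assert (Hi : / Cmod w < / (m / 2)).
{ apply Rinv_lt_contravar; [apply Rmult_lt_0_compat; lra|lra]. }
apply Rlt_le_trans with (eps * (m * m) / 2 * (/ (m / 2) * / m)).
- apply Rmult_le_0_lt_compat.
  + apply Cmod_ge_0.
  + apply Rmult_le_pos; left; apply Rinv_0_lt_compat; lra.
  + lra.
  + apply Rmult_lt_compat_r; [apply Rinv_0_lt_compat; lra|auto].
- right; field; lra.
Qed.

Lemma diff_at_cont (f : C -> C) (z : C) : diff_at f z -> cont_at f z.
Proof.
intros [phi [Hp E]].
apply cont_at_ext_near with (f := fun w => (f z + phi w * (w - z))%C) (r := 1).
- lra.
- intros w _; symmetry; apply E.
- apply (cont_at_plus (fun _ => f z) (fun w => phi w * (w - z))%C).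
  + apply cont_at_const.
  + apply (cont_at_mult phi (fun w => w - z)%C); auto.
    apply (cont_at_plus (fun w => w) (fun _ => - z)%C);
      [apply cont_at_id|apply cont_at_const].
Qed.

Lemma diff_at_const (c z : C) : diff_at (fun _ => c) z.
Proof.
exists (fun _ => RtoC 0); split; [apply cont_at_const|intros w; ring].
Qed.

Lemma diff_at_id (z : C) : diff_at (fun w => w) z.
Proof.
exists (fun _ => RtoC 1); split; [apply cont_at_const|intros w; ring].
Qed.

Lemma diff_at_plus (f g : C -> C) (z : C) :
  diff_at f z -> diff_at g z -> diff_at (fun w => f w + g w)%C z.
Proof.
intros [p [Hp E]] [q [Hq E']].
exists (fun w => p w + q w)%C; split; [now apply cont_at_plus|].
intros w; rewrite (E w), (E' w); ring.
Qed.

Lemma diff_at_mult (f g : C -> C) (z : C) :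
  diff_at f z -> diff_at g z -> diff_at (fun w => f w * g w)%C z.
Proof.
intros Hf Hg.
assert (Cg := diff_at_cont _ _ Hg).
destruct Hf as [p [Hp E]], Hg as [q [Hq E']].
exists (fun w => p w * g w + f z * q w)%C; split.
- apply (cont_at_plus (fun w => p w * g w)%C (fun w => f z * q w)%C).
  + now apply cont_at_mult.
  + apply (cont_at_mult (fun _ => f z) q); auto. apply cont_at_const.
- intros w. rewrite (E w), (E' w). ring.
Qed.

Lemma diff_at_comp (f g : C -> C) (z : C) :
  diff_at f z -> diff_at g (f z) -> diff_at (fun w => g (f w)) z.
Proof.
intros Hf [q [Hq E']].
assert (Cf := diff_at_cont _ _ Hf).
destruct Hf as [p [Hp E]].
exists (fun w => q (f w) * p w)%C; split.
- apply (cont_at_mult (fun w => q (f w)) p); auto.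
  now apply (cont_at_comp f q).
- intros w. rewrite (E' (f w)), (E w). ring.
Qed.

Lemma diff_at_inv (z : C) : z <> RtoC 0 -> diff_at Cinv z.
Proof.
intros Hz.
(* The identity must hold at every [w], including 0, where [Cinv] has a default value; there the
   difference quotient is forced. Continuity at [z] does not see it, since 0 lies at distance
   |z|. *)
exists (fun w => if Ceq_dec w 0 then ((/ 0 - / z) / (0 - z))%C
                 else (- (/ w * / z))%C); split.
- apply cont_at_ext_near with (f := fun w => ((- / z) * / w)%C) (r := Cmod z).
  + now apply Cmod_gt_0.
  + intros w Hw. destruct (Ceq_dec w 0) as [->|_].
    * replace (0 - z)%C with (- z)%C in Hw by ring.
      rewrite Cmod_opp in Hw; lra.
    * ring.
  + apply (cont_at_mult (fun _ => - / z)%C Cinv); [apply cont_at_const|].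
    now apply cont_at_inv.
- intros w. destruct (Ceq_dec w 0) as [->|Hw].
  + assert (N : (0 - z)%C <> RtoC 0) by (apply Cminus_eq_contra; auto).
    unfold Cdiv. rewrite <- Cmult_assoc, Cinv_l by exact N. ring.
  + field; auto.
Qed.

Lemma diff_at_ex_derive (f : C -> C) (z : C) :
  @ex_derive C_AbsRing C_NormedModule f z -> diff_at f z.
Proof.
intros [l [_ Hl]].
specialize (Hl z (fun P H => H)).
exists (fun w => if Ceq_dec w z then l else ((f w - f z) / (w - z))%C); split.
- intros eps Heps.
  assert (He : 0 < eps / 2) by lra.
  destruct (Hl (mkposreal _ He)) as [d Hd].
  exists d; split; [apply cond_pos|].
  intros w Hw.
  destruct (Ceq_dec z z) as [_|N]; [|now elim N].
  destruct (Ceq_dec w z) as [_|Nw].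
  + replace (l - l)%C with (RtoC 0) by ring. now rewrite Cmod_0.
  + specialize (Hd w Hw). simpl in Hd.
    assert (Hwz : (w - z)%C <> RtoC 0) by now apply Cminus_eq_contra.
    assert (Hp := proj1 (Cmod_gt_0 _) Hwz).
    change (Cmod ((f w - f z) - (w - z) * l)%C <= eps / 2 * Cmod (w - z)%C) in Hd.
    replace ((f w - f z) / (w - z) - l)%C
      with (((f w - f z) - (w - z) * l) / (w - z))%C by (field; auto).
    rewrite Cmod_div by auto.
    apply Rle_lt_trans with (eps / 2); [|lra].
    apply Rle_div_l; auto.
- intros w. destruct (Ceq_dec w z) as [->|Nw]; [ring|].
  field. now apply Cminus_eq_contra.
Qed.

(** * Goursat's theorem and the maximum principle on rectangles *)

(** C is taken as a normed module over R, because the integration variable is real. *)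
Definition seg_int (f : R -> C) (a b : R) : C :=
  @RInt C_R_CompleteNormedModule f a b.

Definition seg_cont (f : R -> C) (a b : R) : Prop :=
  forall x, a <= x <= b -> @continuous R_UniformSpace C_UniformSpace f x.

Lemma seg_int_correct (f : R -> C) (a b : R) :
  a <= b -> seg_cont f a b -> @is_RInt C_R_NormedModule f a b (seg_int f a b).
Proof.
intros Hab Hf. apply (@RInt_correct C_R_CompleteNormedModule).
apply (@ex_RInt_continuous C_R_CompleteNormedModule).
intros x; rewrite Rmin_left, Rmax_right by auto. apply Hf.
Qed.

Lemma seg_int_unique (f : R -> C) (a b : R) (l : C) :
  @is_RInt C_R_NormedModule f a b l -> seg_int f a b = l.
Proof. apply (@is_RInt_unique C_R_CompleteNormedModule). Qed.

(** Scalars of [C_R_NormedModule] are real, so a complex factor is handled through real and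
    imaginary parts. *)
Lemma is_RInt_Cmult (c : C) (f : R -> C) (a b : R) (l : C) :
  @is_RInt C_R_NormedModule f a b l ->
  @is_RInt C_R_NormedModule (fun x => c * f x)%C a b (c * l)%C.
Proof.
intros H.
assert (H1 := is_RInt_fct_extend_fst (U := R_NormedModule) (V := R_NormedModule) f a b l H).
assert (H2 := is_RInt_fct_extend_snd (U := R_NormedModule) (V := R_NormedModule) f a b l H).
apply (is_RInt_fct_extend_pair (U := R_NormedModule) (V := R_NormedModule)
         (fun x => c * f x)%C a b); simpl.
- apply (is_RInt_minus (V := R_NormedModule)); apply (is_RInt_scal (V := R_NormedModule)); auto.
- apply (is_RInt_plus (V := R_NormedModule)); apply (is_RInt_scal (V := R_NormedModule)); auto.
Qed.

Lemma seg_int_le (f : R -> C) (a b M : R) :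
  a <= b -> seg_cont f a b -> (forall x, a <= x <= b -> Cmod (f x) <= M) ->
  Cmod (seg_int f a b) <= (b - a) * M.
Proof.
intros Hab Hf HM.
rewrite Cmod_norm.
apply (norm_RInt_le_const (V := C_R_NormedModule) f a b); auto.
- intros x Hx. rewrite <- Cmod_norm. auto.
- now apply seg_int_correct.
Qed.

Definition cont_on_rect (f : C -> C) (x0 x1 y0 y1 : R) : Prop :=
  forall x y, x0 <= x <= x1 -> y0 <= y <= y1 -> cont_at f (x, y).

(* Opposite sides are paired, so that an affine function has constant
   integrands. *)
Definition rect_int (f : C -> C) (x0 x1 y0 y1 : R) : C :=
  (seg_int (fun x => f (x, y0) - f (x, y1)) x0 x1
   + Ci * seg_int (fun y => f (x1, y) - f (x0, y)) y0 y1)%C.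

Lemma Cmod_le_parts (z : C) : Cmod z <= Rabs (Re z) + Rabs (Im z).
Proof.
replace z with (RtoC (Re z) + Ci * RtoC (Im z))%C at 1
  by (destruct z; apply injective_projections; simpl; ring).
eapply Rle_trans; [apply Cmod_triangle|].
rewrite Cmod_mult, Cmod_Ci, !Cmod_R. lra.
Qed.

Lemma im_le_Cmod (z : C) : Rabs (Im z) <= Cmod z.
Proof. eapply Rle_trans; [apply Rmax_r|apply Rmax_Cmod]. Qed.

(** The bridge from [cont_at] to filter continuity on R; the isometry [g] will be a horizontal or a
    vertical line. *)
Lemma continuous_along (f : C -> C) (g : R -> C) (x : R) :
  (forall u v, Cmod (g u - g v)%C = Rabs (u - v)) ->
  cont_at f (g x) ->
  @continuous R_UniformSpace C_UniformSpace (fun u => f (g u)) x.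
Proof.
intros Hg Hf. apply filterlim_locally. intros eps.
destruct (Hf eps (cond_pos eps)) as [d [Hd H]].
exists (mkposreal d Hd). intros u Hu.
assert (Hu' : Cmod (g u - g x)%C < d) by (rewrite Hg; exact Hu).
specialize (H _ Hu').
split.
- change (Rabs (Re (f (g u)) - Re (f (g x))) < eps).
  eapply Rle_lt_trans; [|exact H]. apply (re_le_Cmod (f (g u) - f (g x))).
- change (Rabs (Im (f (g u)) - Im (f (g x))) < eps).
  eapply Rle_lt_trans; [|exact H]. apply (im_le_Cmod (f (g u) - f (g x))).
Qed.

Lemma Cmod_hor (y u v : R) : Cmod ((u, y) - (v, y))%C = Rabs (u - v).
Proof.
replace ((u, y) - (v, y))%C with (RtoC (u - v))
  by (apply injective_projections; simpl; ring).
apply Cmod_R.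
Qed.

Lemma Cmod_ver (x u v : R) : Cmod ((x, u) - (x, v))%C = Rabs (u - v).
Proof.
replace ((x, u) - (x, v))%C with (Ci * RtoC (u - v))%C
  by (apply injective_projections; simpl; ring).
rewrite Cmod_mult, Cmod_Ci, Cmod_R. ring.
Qed.

Lemma seg_cont_hor (f : C -> C) (a b y : R) :
  (forall x, a <= x <= b -> cont_at f (x, y)) -> seg_cont (fun x => f (x, y)) a b.
Proof.
intros Hf x Hx. apply (continuous_along f (fun u => (u, y))); auto.
intros; apply Cmod_hor.
Qed.

Lemma seg_cont_ver (f : C -> C) (a b x : R) :
  (forall y, a <= y <= b -> cont_at f (x, y)) -> seg_cont (fun y => f (x, y)) a b.
Proof.
intros Hf y Hy. apply (continuous_along f (fun u => (x, u))); auto.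
intros; apply Cmod_ver.
Qed.

Lemma seg_cont_minus (f g : R -> C) (a b : R) :
  seg_cont f a b -> seg_cont g a b -> seg_cont (fun x => f x - g x)%C a b.
Proof.
intros Hf Hg x Hx.
apply (continuous_minus (V := C_R_NormedModule) f g); auto.
Qed.

Lemma seg_int_minus (f g : R -> C) (a b : R) :
  a <= b -> seg_cont f a b -> seg_cont g a b ->
  seg_int (fun x => f x - g x)%C a b = (seg_int f a b - seg_int g a b)%C.
Proof.
intros Hab Hf Hg. apply seg_int_unique.
apply (is_RInt_minus (V := C_R_NormedModule)); now apply seg_int_correct.
Qed.

Lemma seg_int_Chasles (f : R -> C) (a b c : R) :
  a <= b <= c -> seg_cont f a c ->
  seg_int f a c = (seg_int f a b + seg_int f b c)%C.
Proof.
intros Hab Hf. apply seg_int_unique.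
apply (is_RInt_Chasles (V := C_R_NormedModule)) with b;
  apply seg_int_correct; try lra; intros x Hx; apply Hf; lra.
Qed.

Definition on_boundary (x0 x1 y0 y1 : R) (z : C) : Prop :=
  (x0 <= Re z <= x1 /\ (Im z = y0 \/ Im z = y1)) \/
  ((Re z = x0 \/ Re z = x1) /\ y0 <= Im z <= y1).

Definition cont_on_bd (f : C -> C) (x0 x1 y0 y1 : R) : Prop :=
  forall z, on_boundary x0 x1 y0 y1 z -> cont_at f z.

Ltac seg_cont_auto Hf :=
  match goal with
  | |- seg_cont (fun x => (@?f x - @?g x)%C) ?a ?b =>
      apply (seg_cont_minus f g a b); seg_cont_auto Hf
  | |- seg_cont (fun x => ?f (x, ?y)) ?a ?b =>
      apply (seg_cont_hor f a b y); intros; apply Hf; left;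
      split; [assumption|first [left; reflexivity|right; reflexivity]]
  | |- seg_cont (fun y => ?f (?x, y)) ?a ?b =>
      apply (seg_cont_ver f a b x); intros; apply Hf; right;
      split; [first [left; reflexivity|right; reflexivity]|assumption]
  end.

(** The form with four separate sides is the one in which inner sides cancel when a rectangle is
    cut; separating the pairs requires integrability, hence continuity on the boundary. *)
Lemma rect_int_unfold (f : C -> C) (x0 x1 y0 y1 : R) :
  x0 <= x1 -> y0 <= y1 -> cont_on_bd f x0 x1 y0 y1 ->
  rect_int f x0 x1 y0 y1
  = (seg_int (fun x => f (x, y0)) x0 x1 - seg_int (fun x => f (x, y1)) x0 x1
     + Ci * (seg_int (fun y => f (x1, y)) y0 y1
             - seg_int (fun y => f (x0, y)) y0 y1))%C.
Proof.
intros Hx Hy Hf. unfold rect_int.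
rewrite !seg_int_minus; auto; seg_cont_auto Hf.
Qed.

Lemma cont_on_rect_bd (f : C -> C) (x0 x1 y0 y1 : R) :
  x0 <= x1 -> y0 <= y1 -> cont_on_rect f x0 x1 y0 y1 -> cont_on_bd f x0 x1 y0 y1.
Proof.
intros Hx Hy Hf [x y] Hz. unfold on_boundary in Hz; simpl in Hz.
apply Hf; intuition lra.
Qed.

Lemma cont_on_rect_sub (f : C -> C) (x0 x1 y0 y1 x0' x1' y0' y1' : R) :
  x0 <= x0' -> x1' <= x1 -> y0 <= y0' -> y1' <= y1 ->
  cont_on_rect f x0 x1 y0 y1 -> cont_on_rect f x0' x1' y0' y1'.
Proof. intros ? ? ? ? Hf x y Hx Hy; apply Hf; lra. Qed.

Lemma rect_int_split_x (f : C -> C) (x0 xm x1 y0 y1 : R) :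
  x0 <= xm <= x1 -> y0 <= y1 -> cont_on_rect f x0 x1 y0 y1 ->
  rect_int f x0 x1 y0 y1
  = (rect_int f x0 xm y0 y1 + rect_int f xm x1 y0 y1)%C.
Proof.
intros Hx Hy Hf.
rewrite !rect_int_unfold; try lra;
  try (apply cont_on_rect_bd, (cont_on_rect_sub f x0 x1 y0 y1); auto; lra).
rewrite (seg_int_Chasles (fun x => f (x, y0)) x0 xm x1); auto;
  [|apply seg_cont_hor; intros; apply Hf; lra].
rewrite (seg_int_Chasles (fun x => f (x, y1)) x0 xm x1); auto;
  [|apply seg_cont_hor; intros; apply Hf; lra].
ring.
Qed.

Lemma rect_int_split_y (f : C -> C) (x0 x1 y0 ym y1 : R) :
  x0 <= x1 -> y0 <= ym <= y1 -> cont_on_rect f x0 x1 y0 y1 ->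
  rect_int f x0 x1 y0 y1
  = (rect_int f x0 x1 y0 ym + rect_int f x0 x1 ym y1)%C.
Proof.
intros Hx Hy Hf.
rewrite !rect_int_unfold; try lra;
  try (apply cont_on_rect_bd, (cont_on_rect_sub f x0 x1 y0 y1); auto; lra).
rewrite (seg_int_Chasles (fun y => f (x0, y)) y0 ym y1); auto;
  [|apply seg_cont_ver; intros; apply Hf; lra].
rewrite (seg_int_Chasles (fun y => f (x1, y)) y0 ym y1); auto;
  [|apply seg_cont_ver; intros; apply Hf; lra].
ring.
Qed.

Lemma rect_int_le (f : C -> C) (x0 x1 y0 y1 M : R) :
  x0 <= x1 -> y0 <= y1 -> cont_on_bd f x0 x1 y0 y1 ->
  (forall z, on_boundary x0 x1 y0 y1 z -> Cmod (f z) <= M) ->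
  Cmod (rect_int f x0 x1 y0 y1) <= 2 * ((x1 - x0) + (y1 - y0)) * M.
Proof.
intros Hx Hy Hf HM. unfold rect_int.
eapply Rle_trans; [apply Cmod_triangle|].
rewrite Cmod_mult, Cmod_Ci, Rmult_1_l.
assert (HM2 : forall z z', on_boundary x0 x1 y0 y1 z -> on_boundary x0 x1 y0 y1 z' ->
  Cmod (f z - f z')%C <= 2 * M).
{ intros z z' Hz Hz'. unfold Cminus. eapply Rle_trans; [apply Cmod_triangle|].
  rewrite Cmod_opp. assert (H1 := HM z Hz). assert (H2 := HM z' Hz'). lra. }
assert (A1 : Cmod (seg_int (fun x => f (x, y0) - f (x, y1))%C x0 x1)
             <= (x1 - x0) * (2 * M)).
{ apply seg_int_le; auto.
  - seg_cont_auto Hf.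
  - intros x Hx'. apply HM2; left; simpl; auto. }
assert (A2 : Cmod (seg_int (fun y => f (x1, y) - f (x0, y))%C y0 y1)
             <= (y1 - y0) * (2 * M)).
{ apply seg_int_le; auto.
  - seg_cont_auto Hf.
  - intros y Hy'. apply HM2; right; simpl; auto. }
lra.
Qed.

Lemma cont_at_opp (f : C -> C) (z : C) : cont_at f z -> cont_at (fun w => - f w)%C z.
Proof.
intros Hf. apply cont_at_ext_near with (f := fun w => (- (1) * f w)%C) (r := 1); try lra.
- intros; ring.
- apply (cont_at_mult (fun _ => - (1))%C f); auto. apply cont_at_const.
Qed.

Lemma cont_at_minus (f g : C -> C) (z : C) :
  cont_at f z -> cont_at g z -> cont_at (fun w => f w - g w)%C z.
Proof. intros Hf Hg. apply (cont_at_plus f (fun w => - g w)%C); auto using cont_at_opp. Qed.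

Lemma rect_int_minus (f g : C -> C) (x0 x1 y0 y1 : R) :
  x0 <= x1 -> y0 <= y1 ->
  cont_on_bd f x0 x1 y0 y1 -> cont_on_bd g x0 x1 y0 y1 ->
  rect_int (fun z => f z - g z)%C x0 x1 y0 y1
  = (rect_int f x0 x1 y0 y1 - rect_int g x0 x1 y0 y1)%C.
Proof.
intros Hx Hy Hf Hg.
rewrite !rect_int_unfold; auto; [|intros z Hz; apply cont_at_minus; auto].
rewrite !(seg_int_minus (fun x => f _) (fun x => g _)); auto;
  try seg_cont_auto Hf; try seg_cont_auto Hg.
ring.
Qed.

Lemma rect_int_scal (c : C) (f : C -> C) (x0 x1 y0 y1 : R) :
  x0 <= x1 -> y0 <= y1 -> cont_on_bd f x0 x1 y0 y1 ->
  rect_int (fun z => c * f z)%C x0 x1 y0 y1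
  = (c * rect_int f x0 x1 y0 y1)%C.
Proof.
intros Hx Hy Hf.
rewrite !rect_int_unfold; auto.
2:{ intros z Hz. apply (cont_at_mult (fun _ => c) f); auto.
    apply cont_at_const. }
assert (K : forall h a b, a <= b -> seg_cont h a b ->
  seg_int (fun x => c * h x)%C a b = (c * seg_int h a b)%C).
{ intros h a b Hab Hh. apply seg_int_unique, is_RInt_Cmult.
  now apply seg_int_correct. }
rewrite !(K (fun x => f _)); auto; try seg_cont_auto Hf.
ring.
Qed.

Lemma rect_int_ext (f g : C -> C) (x0 x1 y0 y1 : R) :
  x0 <= x1 -> y0 <= y1 ->
  (forall z, on_boundary x0 x1 y0 y1 z -> f z = g z) ->
  rect_int f x0 x1 y0 y1 = rect_int g x0 x1 y0 y1.
Proof.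
intros Hx Hy E. unfold rect_int, seg_int.
f_equal; [|f_equal]; apply (@RInt_ext C_R_CompleteNormedModule);
  intros u; rewrite Rmin_left, Rmax_right by auto; intros Hu;
  rewrite !E; auto; unfold on_boundary; simpl; lra.
Qed.

Lemma rect_int_affine (u v : C) (x0 x1 y0 y1 : R) :
  rect_int (fun z => u + v * z)%C x0 x1 y0 y1 = RtoC 0.
Proof.
assert (K : forall (h : R -> C) (c : C) a b, (forall x, h x = c) ->
   seg_int h a b = (RtoC (b - a) * c)%C).
{ intros h c a b Hh. apply seg_int_unique.
  apply (is_RInt_ext (V := C_R_NormedModule) (fun _ => c)).
  - intros x _; now rewrite Hh.
  - rewrite <- scal_R_Cmult.
    apply (is_RInt_const (V := C_R_NormedModule)). }
unfold rect_int.
rewrite (K _ (v * (Ci * RtoC (y0 - y1)))%C).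
2:{ intros x. replace (Ci * RtoC (y0 - y1))%C with ((x, y0) - (x, y1))%C
      by (apply injective_projections; simpl; ring). ring. }
rewrite (K _ (v * RtoC (x1 - x0))%C).
2:{ intros y. replace (RtoC (x1 - x0))%C with ((x1, y) - (x0, y))%C
      by (apply injective_projections; simpl; ring). ring. }
rewrite !RtoC_minus. ring.
Qed.

(** * Bisection and Goursat's theorem *)

(** [P x y h] speaks of the rectangle with lower left corner (x, y) and sides hW, hH. If [P] failed
    at scale 1, it would fail on one of the four quarters, and so on down; the nested failing
    rectangles share a point, near which the local hypothesis contradicts the failure. *)
Lemma rect_bisection (W H : R) (P : R -> R -> R -> Prop) (x0 y0 : R) :
  0 <= W -> 0 <= H ->
  (forall x y h, 0 < h ->
     P x y (h / 2) -> P (x + h / 2 * W) y (h / 2) ->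
     P x (y + h / 2 * H) (h / 2) -> P (x + h / 2 * W) (y + h / 2 * H) (h / 2) ->
     P x y h) ->
  (forall px py, x0 <= px <= x0 + W -> y0 <= py <= y0 + H ->
     exists delta, 0 < delta /\ forall x y h, 0 < h < delta ->
       x <= px <= x + h * W -> y <= py <= y + h * H -> P x y h) ->
  P x0 y0 1.
Proof.
intros HW HH Hglue Hloc.
destruct (classic (P x0 y0 1)) as [|Hbad]; [assumption|exfalso].
(* Failing rectangles are packed in a subtype, so that choice turns [step] into a self-map that can
   be iterated. *)
set (T := {c : R * R * R | 0 < snd c /\ ~ P (fst (fst c)) (snd (fst c)) (snd c)}).
assert (step : forall c : T, exists c' : T,
  snd (proj1_sig c') = snd (proj1_sig c) / 2 /\
  fst (fst (proj1_sig c)) <= fst (fst (proj1_sig c')) /\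
  fst (fst (proj1_sig c')) + snd (proj1_sig c') * W
    <= fst (fst (proj1_sig c)) + snd (proj1_sig c) * W /\
  snd (fst (proj1_sig c)) <= snd (fst (proj1_sig c')) /\
  snd (fst (proj1_sig c')) + snd (proj1_sig c') * H
    <= snd (fst (proj1_sig c)) + snd (proj1_sig c) * H).
{ intros [[[x y] h] [Hh Hn]]; simpl in *.
  assert (M1 : 0 <= h * W) by nra. assert (M2 : 0 <= h * H) by nra.
  assert (K : forall x' y', ~ P x' y' (h / 2) -> exists c' : T,
    proj1_sig c' = (x', y', h / 2)).
  { intros x' y' Hn'.
    exists (exist _ (x', y', h / 2) (conj (Rdiv_lt_0_compat h 2 Hh Rlt_0_2) Hn')).
    reflexivity. }
  destruct (classic (P x y (h / 2))) as [H1|H1].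
  2:{ destruct (K _ _ H1) as [c' E]; exists c'; rewrite E; simpl; lra. }
  destruct (classic (P (x + h / 2 * W) y (h / 2))) as [H2|H2].
  2:{ destruct (K _ _ H2) as [c' E]; exists c'; rewrite E; simpl; lra. }
  destruct (classic (P x (y + h / 2 * H) (h / 2))) as [H3|H3].
  2:{ destruct (K _ _ H3) as [c' E]; exists c'; rewrite E; simpl; lra. }
  destruct (classic (P (x + h / 2 * W) (y + h / 2 * H) (h / 2))) as [H4|H4].
  2:{ destruct (K _ _ H4) as [c' E]; exists c'; rewrite E; simpl; lra. }
  elim Hn; auto. }
set (nxt := fun c => proj1_sig (constructive_indefinite_description _ (step c))).
assert (Hnxt : forall c, _) by
  exact (fun c => proj2_sig (constructive_indefinite_description _ (step c))).
fold T in Hnxt.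
set (c0 := exist (fun c : R * R * R => 0 < snd c /\ ~ P (fst (fst c)) (snd (fst c)) (snd c))
             (x0, y0, 1) (conj Rlt_0_1 Hbad) : T).
set (u := fun n => Nat.iter n nxt c0).
set (X := fun n => fst (fst (proj1_sig (u n)))).
set (Y := fun n => snd (fst (proj1_sig (u n)))).
set (h := fun n => snd (proj1_sig (u n))).
assert (Hstep : forall n, h (S n) = h n / 2 /\ X n <= X (S n) /\
  X (S n) + h (S n) * W <= X n + h n * W /\ Y n <= Y (S n) /\
  Y (S n) + h (S n) * H <= Y n + h n * H).
{ intros n. exact (Hnxt (u n)). }
assert (Hpos : forall n, 0 < h n /\ ~ P (X n) (Y n) (h n)).
{ intros n. exact (proj2_sig (u n)). }
assert (Hh : forall n, h n = (1 / 2) ^ n).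
{ induction n as [|n IH]; [reflexivity|].
  destruct (Hstep n) as [E _]. rewrite E, IH. simpl. field. }
(* Used for both coordinates: the lower ends increase, each is bounded by every upper end, and so
   their limit lies in all the intervals. *)
assert (lim : forall (Z : nat -> R) (A : R), 0 <= A ->
  (forall n, Z n <= Z (S n)) ->
  (forall n, Z (S n) + h (S n) * A <= Z n + h n * A) ->
  exists l, forall n, Z n <= l <= Z n + h n * A).
{ intros Z A HA Hg Hd.
  assert (Hd' : forall n m, Z (n + m)%nat + h (n + m)%nat * A <= Z n + h n * A).
  { intros n m; induction m as [|m IH].
    - rewrite Nat.add_0_r; lra.
    - rewrite Nat.add_succ_r. specialize (Hd (n + m)%nat). lra. }
  assert (Hb : forall n m, Z m <= Z n + h n * A).
  { intros n m.
    assert (Hm : Z m <= Z (n + m)%nat).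
    { clear -Hg. induction n as [|n IH]; simpl; [lra|].
      specialize (Hg (n + m)%nat); lra. }
    specialize (Hd' n m).
    destruct (Hpos (n + m)%nat) as [Hp _]. nra. }
  destruct (growing_cv Z Hg) as [l Hl].
  { exists (Z 0%nat + h 0%nat * A). intros r [n ->]. apply Hb. }
  exists l. intros n. split.
  - apply growing_ineq; auto.
  - apply Rnot_lt_le. intros Hlt.
    destruct (Hl (l - (Z n + h n * A))) as [N HN]; [lra|].
    specialize (HN N (le_n _)). unfold Rdist in HN.
    specialize (Hb n N). apply Rabs_def2 in HN. lra. }
destruct (lim X W HW) as [px Hpx]; [apply Hstep|apply Hstep|].
destruct (lim Y H HH) as [py Hpy]; [apply Hstep|apply Hstep|].
destruct (Hloc px py) as [d [Hd HP]].
{ specialize (Hpx 0%nat); unfold X, h in Hpx; simpl in Hpx; lra. }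
{ specialize (Hpy 0%nat); unfold Y, h in Hpy; simpl in Hpy; lra. }
destruct (pow_lt_1_zero (1 / 2)) with (y := d) as [N HN]; auto.
{ rewrite Rabs_pos_eq; lra. }
specialize (HN N (le_n _)).
apply (proj2 (Hpos N)). apply HP; auto.
split; [apply Hpos|]. rewrite Hh. apply Rabs_def2 in HN; lra.
Qed.

(** The bisected property is the estimate 2 eps (hD)^2, where D is half the perimeter. It is stable
    under gluing because 4 (h/2)^2 = h^2. Near a point p, subtracting the tangent affine map, whose
    integral vanishes, leaves an integrand of size eps hD on a boundary of length 2hD. Finally eps
    is arbitrary. *)
Theorem Goursat (f : C -> C) (x0 x1 y0 y1 : R) :
  x0 <= x1 -> y0 <= y1 ->
  (forall x y, x0 <= x <= x1 -> y0 <= y <= y1 -> diff_at f (x, y)) ->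
  rect_int f x0 x1 y0 y1 = RtoC 0.
Proof.
intros Hx Hy Hd.
assert (Hc : cont_on_rect f x0 x1 y0 y1).
{ intros x y Hx' Hy'. now apply diff_at_cont, Hd. }
set (W := x1 - x0). set (H := y1 - y0). set (D := W + H).
assert (HW : 0 <= W) by (unfold W; lra).
assert (HH : 0 <= H) by (unfold H; lra).
assert (K : forall eps, 0 < eps ->
  Cmod (rect_int f x0 x1 y0 y1) <= 2 * eps * (D * D)).
{ intros eps Heps.
  pose (P := fun x y h => x0 <= x -> x + h * W <= x1 -> y0 <= y -> y + h * H <= y1 ->
    Cmod (rect_int f x (x + h * W) y (y + h * H)) <= 2 * eps * (D * D) * (h * h)).
  assert (HP : P x0 y0 1).
  { apply (rect_bisection W H P); auto; unfold P.
    - intros x y h Hh P1 P2 P3 P4 B1 B2 B3 B4.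
      assert (M1 : 0 <= h * W) by nra. assert (M2 : 0 <= h * H) by nra.
      rewrite (rect_int_split_x f _ (x + h / 2 * W)); try lra;
        [|apply (cont_on_rect_sub f x0 x1 y0 y1); auto; lra].
      rewrite (rect_int_split_y f x (x + h / 2 * W) _ (y + h / 2 * H)); try lra;
        [|apply (cont_on_rect_sub f x0 x1 y0 y1); auto; lra].
      rewrite (rect_int_split_y f (x + h / 2 * W) (x + h * W) _ (y + h / 2 * H)); try lra;
        [|apply (cont_on_rect_sub f x0 x1 y0 y1); auto; lra].
      specialize (P1 ltac:(lra) ltac:(lra) ltac:(lra) ltac:(lra)).
      specialize (P2 ltac:(lra) ltac:(lra) ltac:(lra) ltac:(lra)).
      specialize (P3 ltac:(lra) ltac:(lra) ltac:(lra) ltac:(lra)).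
      specialize (P4 ltac:(lra) ltac:(lra) ltac:(lra) ltac:(lra)).
      replace (x + h / 2 * W + h / 2 * W) with (x + h * W) in * by field.
      replace (y + h / 2 * H + h / 2 * H) with (y + h * H) in * by field.
      eapply Rle_trans; [apply Cmod_triangle|].
      eapply Rle_trans; [apply Rplus_le_compat; apply Cmod_triangle|].
      lra.
    - intros px py Hpx Hpy.
      destruct (Hd px py) as [phi [Hphi E]]; [unfold W in *; lra|unfold H in *; lra|].
      destruct (Hphi eps Heps) as [d [Hd' Hphi']].
      assert (HD1 : 0 < D + 1) by (unfold D; lra).
      (* D may be 0 for a degenerate rectangle, hence D + 1. *)
      exists (d / (D + 1)); split; [now apply Rdiv_lt_0_compat|].
      intros x y h [Hh Hhd] Hpx' Hpy' B1 B2 B3 B4.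
      assert (HhD : h * D < d).
      { apply (Rmult_lt_compat_r (D + 1)) in Hhd; auto.
        unfold Rdiv in Hhd. rewrite Rmult_assoc, Rinv_l in Hhd by lra. nra. }
      set (p := (px, py) : C).
      set (aff := fun z => ((f p - phi p * p) + phi p * z)%C).
      assert (Haff : forall z, cont_at aff z).
      { intros z. apply (cont_at_plus (fun _ => f p - phi p * p)%C (fun z => phi p * z)%C).
        - apply cont_at_const.
        - apply (cont_at_mult (fun _ => phi p) (fun z => z));
            [apply cont_at_const|apply cont_at_id]. }
      assert (M1 : 0 <= h * W) by nra. assert (M2 : 0 <= h * H) by nra.
      assert (Hsub : cont_on_bd f x (x + h * W) y (y + h * H)).
      { apply cont_on_rect_bd; try lra. apply (cont_on_rect_sub f x0 x1 y0 y1); auto; lra. }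
      assert (Haff' : cont_on_bd aff x (x + h * W) y (y + h * H))
        by (intros ? _; apply Haff).
      replace (rect_int f x (x + h * W) y (y + h * H))
        with (rect_int (fun z => f z - aff z)%C x (x + h * W) y (y + h * H)).
      2:{ rewrite rect_int_minus; auto; try lra. unfold aff at 1.
          rewrite rect_int_affine. ring. }
      eapply Rle_trans; [apply (rect_int_le _ _ _ _ _ (eps * (h * D))); try lra|].
      + intros z Hz. apply cont_at_minus; auto.
      + intros z Hz.
        assert (Hzp : Cmod (z - p)%C <= h * D).
        { eapply Rle_trans; [apply Cmod_le_parts|].
          destruct z as [zx zy]; simpl in *. unfold D.
          unfold on_boundary in Hz; simpl in Hz.
          apply Rle_trans with (h * W + h * H); [|lra].
          apply Rplus_le_compat; apply Rabs_le; lra. }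
        replace (f z - aff z)%C with ((phi z - phi p) * (z - p))%C
          by (unfold aff; rewrite (E z); fold p; ring).
        rewrite Cmod_mult. apply Rmult_le_compat; try apply Cmod_ge_0; auto.
        left. apply Hphi'. fold p. lra.
      + right. unfold D. ring. }
  specialize (HP ltac:(lra)). rewrite !Rmult_1_l in HP.
  unfold W, H in HP. replace (x0 + (x1 - x0)) with x1 in HP by ring.
  replace (y0 + (y1 - y0)) with y1 in HP by ring.
  fold W H in HP. specialize (HP ltac:(lra) ltac:(lra) ltac:(lra)). lra. }
apply Cmod_eq_0. apply Rle_antisym; [|apply Cmod_ge_0].
apply Rnot_lt_le. intros Hlt.
(* With eps = I / (4 (D^2 + 1)) the estimate would give I <= I/2. *)
set (I := Cmod (rect_int f x0 x1 y0 y1)) in *.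
assert (HDD : 0 <= D * D) by nra.
specialize (K (I / (4 * (D * D + 1)))).
assert (P0 : 0 < I / (4 * (D * D + 1))) by (apply Rdiv_lt_0_compat; lra).
specialize (K P0).
assert (E : I / (4 * (D * D + 1)) * (4 * (D * D + 1)) = I) by (field; lra).
nra.
Qed.

(** * Cauchy's formula and the maximum principle *)

Lemma diff_at_ext_near (f g : C -> C) (z : C) (r : R) :
  0 < r -> (forall w, Cmod (w - z) < r -> f w = g w) ->
  diff_at f z -> diff_at g z.
Proof.
intros Hr E [p [Hp Ef]].
assert (Ez : f z = g z).
{ apply E. replace (z - z)%C with (RtoC 0) by ring. now rewrite Cmod_0. }
exists (fun w => if Rlt_dec (Cmod (w - z)) r then p w
                 else ((g w - g z) / (w - z))%C); split.
- apply cont_at_ext_near with (f := p) (r := r); auto.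
  intros w Hw. destruct (Rlt_dec (Cmod (w - z)) r); [reflexivity|lra].
- intros w. destruct (Rlt_dec (Cmod (w - z)) r) as [Hw|Hw].
  + rewrite <- Ez, <- (E w Hw). apply Ef.
  + field. intros E0. rewrite E0, Cmod_0 in Hw. lra.
Qed.

(** A square of half-side r is cut out around the exceptional point. The four surrounding rectangles
    contribute nothing by [Goursat], and the square contributes at most 8rM, M being a bound for |g|
    near the point; r <= I / (16 M) then contradicts I > 0. *)
Lemma rect_int_punctured (g : C -> C) (x0 x1 y0 y1 ax ay : R) :
  x0 < ax < x1 -> y0 < ay < y1 ->
  cont_on_rect g x0 x1 y0 y1 ->
  (forall x y, x0 <= x <= x1 -> y0 <= y <= y1 -> x <> ax \/ y <> ay ->
     diff_at g (x, y)) ->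
  rect_int g x0 x1 y0 y1 = RtoC 0.
Proof.
intros Hax Hay Hc Hd.
assert (Hr : forall r, 0 < r -> x0 < ax - r -> ax + r < x1 ->
  y0 < ay - r -> ay + r < y1 ->
  rect_int g x0 x1 y0 y1 = rect_int g (ax - r) (ax + r) (ay - r) (ay + r)).
{ intros r Hr H1 H2 H3 H4.
  assert (Hsub : forall x0' x1' y0' y1', x0 <= x0' -> x1' <= x1 -> y0 <= y0' ->
    y1' <= y1 -> cont_on_rect g x0' x1' y0' y1').
  { intros. apply (cont_on_rect_sub g x0 x1 y0 y1); auto. }
  rewrite (rect_int_split_y g x0 x1 y0 (ay - r) y1) by (auto; lra).
  rewrite (Goursat g x0 x1 y0 (ay - r)) by (intros; try apply Hd; lra).
  rewrite (rect_int_split_y g x0 x1 (ay - r) (ay + r) y1);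
    try (apply Hsub); try lra.
  rewrite (Goursat g x0 x1 (ay + r) y1) by (intros; try apply Hd; lra).
  rewrite (rect_int_split_x g x0 (ax - r) x1);
    try (apply Hsub); try lra.
  rewrite (Goursat g x0 (ax - r)) by (intros; try apply Hd; lra).
  rewrite (rect_int_split_x g (ax - r) (ax + r) x1);
    try (apply Hsub); try lra.
  rewrite (Goursat g (ax + r) x1) by (intros; try apply Hd; lra).
  ring. }
destruct (Hc ax ay ltac:(lra) ltac:(lra) 1 Rlt_0_1) as [d [Hd0 Hd1]].
set (M := Cmod (g (ax, ay)) + 1).
assert (HM : 0 < M) by (unfold M; generalize (Cmod_ge_0 (g (ax, ay))); lra).
apply Cmod_eq_0. apply Rle_antisym; [|apply Cmod_ge_0].
apply Rnot_lt_le; intros Hlt. set (I := Cmod (rect_int g x0 x1 y0 y1)) in *.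
set (m := Rmin (Rmin (ax - x0) (x1 - ax)) (Rmin (ay - y0) (y1 - ay))).
set (r := Rmin (Rmin (m / 2) (d / 4)) (I / (16 * M))).
assert (Hm : 0 < m) by (unfold m; repeat apply Rmin_pos; lra).
assert (Hr0 : 0 < r).
{ unfold r; repeat apply Rmin_pos; try lra. apply Rdiv_lt_0_compat; lra. }
assert (R1 : r <= m / 2) by (unfold r; eapply Rle_trans; [apply Rmin_l|apply Rmin_l]).
assert (R2 : r <= d / 4) by (unfold r; eapply Rle_trans; [apply Rmin_l|apply Rmin_r]).
assert (R3 : r <= I / (16 * M)) by (unfold r; apply Rmin_r).
assert (m1 : m <= ax - x0) by (unfold m; eapply Rle_trans; [apply Rmin_l|apply Rmin_l]).
assert (m2 : m <= x1 - ax) by (unfold m; eapply Rle_trans; [apply Rmin_l|apply Rmin_r]).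
assert (m3 : m <= ay - y0) by (unfold m; eapply Rle_trans; [apply Rmin_r|apply Rmin_l]).
assert (m4 : m <= y1 - ay) by (unfold m; eapply Rle_trans; [apply Rmin_r|apply Rmin_r]).
assert (B : I <= 2 * ((ax + r - (ax - r)) + (ay + r - (ay - r))) * M).
{ unfold I. rewrite (Hr r) by lra. apply rect_int_le; try lra.
  - apply cont_on_rect_bd; try lra.
    apply (cont_on_rect_sub g x0 x1 y0 y1); auto; lra.
  - intros [zx zy] Hz. unfold on_boundary in Hz; simpl in Hz.
    replace (g (zx, zy)) with ((g (zx, zy) - g (ax, ay)) + g (ax, ay))%C by ring.
    eapply Rle_trans; [apply Cmod_triangle|]. unfold M.
    assert (Cmod (g (zx, zy) - g (ax, ay))%C < 1); [|lra].
    apply Hd1. eapply Rle_lt_trans; [apply Cmod_le_parts|]. simpl.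
    apply Rle_lt_trans with (r + r); [|lra].
    apply Rplus_le_compat; apply Rabs_le; lra. }
apply (Rmult_le_compat_r (16 * M)) in R3; [|lra].
unfold Rdiv in R3. rewrite Rmult_assoc, Rinv_l in R3 by lra. nra.
Qed.

Lemma seg_int_re_im (f : R -> C) (a b : R) :
  a <= b -> seg_cont f a b ->
  Re (seg_int f a b) = RInt (fun x => Re (f x)) a b /\
  Im (seg_int f a b) = RInt (fun x => Im (f x)) a b.
Proof.
intros Hab Hf. assert (H := seg_int_correct f a b Hab Hf).
split; symmetry; apply is_RInt_unique.
- apply (is_RInt_fct_extend_fst (U := R_NormedModule) (V := R_NormedModule) f a b _ H).
- apply (is_RInt_fct_extend_snd (U := R_NormedModule) (V := R_NormedModule) f a b _ H).
Qed.

Lemma seg_cont_re_im (f : R -> C) (a b x : R) :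
  seg_cont f a b -> a <= x <= b ->
  continuous (fun x => Re (f x)) x /\ continuous (fun x => Im (f x)) x.
Proof.
intros Hf Hx. specialize (Hf x Hx). split.
- apply (continuous_comp (U := R_UniformSpace) (V := C_UniformSpace) f
           (fun z : C => fst z)); auto.
  apply (continuous_fst (U := R_UniformSpace) (V := R_UniformSpace)).
- apply (continuous_comp (U := R_UniformSpace) (V := C_UniformSpace) f
           (fun z : C => snd z)); auto.
  apply (continuous_snd (U := R_UniformSpace) (V := R_UniformSpace)).
Qed.

Lemma cont_at_inv_shift (a z : C) : z <> a -> cont_at (fun w => / (w - a))%C z.
Proof.
intros H. apply (cont_at_comp (fun w => w - a)%C Cinv).
- apply (cont_at_plus (fun w => w) (fun _ => - a)%C);
    [apply cont_at_id|apply cont_at_const].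
- apply cont_at_inv. now apply Cminus_eq_contra.
Qed.

Lemma on_boundary_neq (x0 x1 y0 y1 : R) (a z : C) :
  x0 < Re a < x1 -> y0 < Im a < y1 -> on_boundary x0 x1 y0 y1 z -> z <> a.
Proof.
intros Hx Hy Hz ->. unfold on_boundary in Hz. lra.
Qed.

(** Positivity makes this integral a nonzero factor by which Cauchy's formula can be divided. Each
    pair of opposite sides contributes to the imaginary part the integral of two positive terms v /
    (u^2 + v^2), where v is the distance from [a] to a side. *)
Lemma rect_int_inv (x0 x1 y0 y1 : R) (a : C) :
  x0 < Re a < x1 -> y0 < Im a < y1 ->
  0 < Im (rect_int (fun z => / (z - a))%C x0 x1 y0 y1).
Proof.
intros Hx Hy. destruct a as [ax ay]; simpl in Hx, Hy. unfold rect_int.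
set (g := fun z => (/ (z - (ax, ay)))%C).
assert (Hg : cont_on_bd g x0 x1 y0 y1).
{ intros z Hz. apply cont_at_inv_shift.
  apply (on_boundary_neq x0 x1 y0 y1); auto. }
assert (H1 : seg_cont (fun x => g (x, y0) - g (x, y1))%C x0 x1) by seg_cont_auto Hg.
assert (H2 : seg_cont (fun y => g (x1, y) - g (x0, y))%C y0 y1) by seg_cont_auto Hg.
change (0 < Im (seg_int (fun x => g (x, y0) - g (x, y1))%C x0 x1
         + Ci * seg_int (fun y => g (x1, y) - g (x0, y))%C y0 y1)).
rewrite im_plus, im_mult.
replace (Re Ci) with 0 by reflexivity. replace (Im Ci) with 1 by reflexivity.
rewrite (proj2 (seg_int_re_im _ x0 x1 ltac:(lra) H1)).
rewrite (proj1 (seg_int_re_im _ y0 y1 ltac:(lra) H2)).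
rewrite Rmult_0_l, Rplus_0_l, Rmult_1_l.
assert (Q : forall u v, 0 < v -> 0 < v / (u ^ 2 + v ^ 2)).
{ intros u v Hv. apply Rdiv_lt_0_compat; auto.
  apply Rplus_le_lt_0_compat; [apply pow2_ge_0|now apply pow_lt]. }
assert (Q' : forall u v, v <> 0 -> u * u + v * v <> 0).
{ intros u v Hv. assert (H3 := Rsqr_pos_lt v Hv). unfold Rsqr in H3. nra. }
apply Rplus_lt_0_compat; apply RInt_gt_0; try lra.
- intros x _. unfold g. simpl.
  generalize (Q (x - ax) (ay - y0) ltac:(lra)) (Q (x - ax) (y1 - ay) ltac:(lra)).
  intros A B.
  match goal with |- 0 < ?e => replace e with
    ((ay - y0) / ((x - ax) ^ 2 + (ay - y0) ^ 2)
     + (y1 - ay) / ((x - ax) ^ 2 + (y1 - ay) ^ 2)) end; [lra|].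
  field. split; first [apply Q'; lra|rewrite Rplus_comm; apply Q'; lra].
- intros x Hx'. apply (seg_cont_re_im _ x0 x1 x H1 Hx').
- intros y _. unfold g. simpl.
  generalize (Q (y - ay) (ax - x0) ltac:(lra)) (Q (y - ay) (x1 - ax) ltac:(lra)).
  intros A B.
  match goal with |- 0 < ?e => replace e with
    ((ax - x0) / ((y - ay) ^ 2 + (ax - x0) ^ 2)
     + (x1 - ax) / ((y - ay) ^ 2 + (x1 - ax) ^ 2)) end; [lra|].
  field. split; first [apply Q'; lra|rewrite Rplus_comm; apply Q'; lra].
- intros y Hy'. apply (seg_cont_re_im _ y0 y1 y H2 Hy').
Qed.

(** The difference of the two sides is, up to sign, the integral of the Caratheodory quotient [phi]
    of f at a. It is continuous everywhere and differentiable off a, so [rect_int_punctured]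
    applies. *)
Lemma Cauchy_rect (f : C -> C) (x0 x1 y0 y1 : R) (a : C) :
  (forall z, diff_at f z) -> x0 < Re a < x1 -> y0 < Im a < y1 ->
  (f a * rect_int (fun z => / (z - a)) x0 x1 y0 y1)%C
  = rect_int (fun z => f z * / (z - a))%C x0 x1 y0 y1.
Proof.
intros Hf Hx Hy.
destruct (Hf a) as [phi [Hphi E]].
assert (Hd : forall z, z <> a -> diff_at phi z).
{ intros z Hz.
  assert (Hr : 0 < Cmod (z - a)) by (apply Cmod_gt_0; now apply Cminus_eq_contra).
  apply diff_at_ext_near with (f := fun w => ((f w + - f a) * / (w + - a))%C)
    (r := Cmod (z - a)); auto.
  - intros w Hw. rewrite (E w).
    assert (Hw' : (w + - a)%C <> RtoC 0).
    { intros E0. replace (w - z)%C with (- (z - a) + (w + - a))%C in Hw by ring.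
      rewrite E0 in Hw. rewrite Cplus_0_r, Cmod_opp in Hw. lra. }
    field. exact Hw'.
  - apply (diff_at_mult (fun w => f w + - f a)%C (fun w => / (w + - a))%C).
    + apply (diff_at_plus f (fun _ => - f a)%C); auto. apply diff_at_const.
    + apply (diff_at_comp (fun w => w + - a)%C Cinv).
      * apply (diff_at_plus (fun w => w) (fun _ => - a)%C);
          [apply diff_at_id|apply diff_at_const].
      * apply diff_at_inv. now apply Cminus_eq_contra. }
assert (Hc : forall z, cont_at phi z).
{ intros z. destruct (Ceq_dec z a) as [->|Hz]; auto. now apply diff_at_cont, Hd. }
assert (Hi : cont_on_bd (fun z => / (z - a))%C x0 x1 y0 y1).
{ intros z Hz. apply cont_at_inv_shift. eapply on_boundary_neq; eauto. }
assert (Hfi : cont_on_bd (fun z => f z * / (z - a))%C x0 x1 y0 y1).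
{ intros z Hz. apply (cont_at_mult f (fun z => / (z - a))%C); auto.
  now apply diff_at_cont. }
assert (H0 : rect_int phi x0 x1 y0 y1 = RtoC 0).
{ apply (rect_int_punctured phi _ _ _ _ (Re a) (Im a)); auto.
  - intros x y _ _; apply Hc.
  - intros x y _ _ Hxy. apply Hd. intros E'. rewrite <- E' in Hxy. simpl in Hxy. lra. }
rewrite <- rect_int_scal by (auto; lra).
rewrite (rect_int_ext _ (fun z => f z * / (z - a) - phi z)%C); try lra.
- rewrite rect_int_minus; try lra; auto.
  + rewrite H0. ring.
  + intros z _; apply Hc.
- intros z Hz. rewrite (E z). field.
  apply Cminus_eq_contra. eapply on_boundary_neq; eauto.
Qed.

Lemma diff_at_pow (f : C -> C) (z : C) (n : nat) :
  diff_at f z -> diff_at (fun w => f w ^ n)%C z.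
Proof.
intros Hf. induction n as [|n IH].
- apply (diff_at_const (RtoC 1)).
- apply (diff_at_mult f (fun w => f w ^ n)%C); auto.
Qed.

(* Landau's trick: Cauchy's formula bounds |f(a)|^n by a constant times M^n,
   and the constant disappears as n grows. *)
Theorem max_modulus_rect (f : C -> C) (x0 x1 y0 y1 M : R) (a : C) :
  (forall z, diff_at f z) -> x0 < Re a < x1 -> y0 < Im a < y1 ->
  (forall z, on_boundary x0 x1 y0 y1 z -> Cmod (f z) <= M) ->
  Cmod (f a) <= M.
Proof.
intros Hf Hx Hy HM.
set (I := rect_int (fun z => / (z - a))%C x0 x1 y0 y1).
assert (HI : 0 < Cmod I).
{ assert (H := rect_int_inv x0 x1 y0 y1 a Hx Hy). fold I in H.
  assert (H' := im_le_Cmod I). rewrite Rabs_pos_eq in H'; lra. }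
set (m := Rmin (Rmin (Re a - x0) (x1 - Re a)) (Rmin (Im a - y0) (y1 - Im a))).
assert (Hm : 0 < m) by (unfold m; repeat apply Rmin_pos; lra).
assert (m1 : m <= Re a - x0) by (unfold m; eapply Rle_trans; [apply Rmin_l|apply Rmin_l]).
assert (m2 : m <= x1 - Re a) by (unfold m; eapply Rle_trans; [apply Rmin_l|apply Rmin_r]).
assert (m3 : m <= Im a - y0) by (unfold m; eapply Rle_trans; [apply Rmin_r|apply Rmin_l]).
assert (m4 : m <= y1 - Im a) by (unfold m; eapply Rle_trans; [apply Rmin_r|apply Rmin_r]).
assert (Hdist : forall z, on_boundary x0 x1 y0 y1 z -> m <= Cmod (z - a)%C).
{ intros z Hz. unfold on_boundary in Hz.
  assert (A := re_le_Cmod (z - a)%C). assert (B := im_le_Cmod (z - a)%C).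
  assert (A1 := Rle_abs (Re (z - a)%C)). assert (A2 := Rle_abs (- Re (z - a)%C)).
  assert (B1 := Rle_abs (Im (z - a)%C)). assert (B2 := Rle_abs (- Im (z - a)%C)).
  rewrite Rabs_Ropp in A2, B2. destruct z as [zx zy], a as [ax ay]; simpl in *. lra. }
assert (HM0 : 0 <= M).
{ eapply Rle_trans; [apply Cmod_ge_0|].
  apply (HM (x0, y0)). left; simpl; lra. }
set (K := 2 * ((x1 - x0) + (y1 - y0)) / m).
(* Cauchy's formula for f^n; K is the perimeter divided by the least distance m from a to the
   boundary, hence independent of n. *)
assert (HK : forall n, Cmod (f a) ^ n * Cmod I <= K * M ^ n).
{ intros n. rewrite <- Cmod_pow, <- Cmod_mult. unfold I.
  rewrite (Cauchy_rect (fun z => f z ^ n)%C x0 x1 y0 y1 a); auto;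
    [|intros z; now apply diff_at_pow].
  replace (K * M ^ n) with (2 * ((x1 - x0) + (y1 - y0)) * (M ^ n / m))
    by (unfold K; field; lra).
  apply rect_int_le; try lra.
  - intros z Hz. apply (cont_at_mult (fun z => f z ^ n)%C (fun z => / (z - a))%C).
    + now apply diff_at_cont, diff_at_pow.
    + apply cont_at_inv_shift. eapply on_boundary_neq; eauto.
  - intros z Hz. rewrite Cmod_mult, Cmod_pow, Cmod_inv.
    2:{ apply Cminus_eq_contra. eapply on_boundary_neq; eauto. }
    apply Rmult_le_compat.
    + apply pow_le, Cmod_ge_0.
    + left; apply Rinv_0_lt_compat. specialize (Hdist z Hz); lra.
    + apply pow_incr; split; [apply Cmod_ge_0|auto].
    + apply Rinv_le_contravar; auto. }
apply Rnot_lt_le; intros Hlt.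
(* For M > 0 the powers of |f(a)|/M > 1 would exceed K/|I|; for M = 0 the case n = 1 is already a
   contradiction. *)
destruct (Rle_lt_or_eq_dec 0 M HM0) as [Mp|M0].
- assert (Hq : 1 < Cmod (f a) / M).
  { apply Rlt_div_r; lra. }
  destruct (Pow_x_infinity (Cmod (f a) / M)) with (b := K / Cmod I + 1) as [N HN].
  { rewrite Rabs_pos_eq; lra. }
  specialize (HN N (le_n _)). specialize (HK N).
  rewrite Rabs_pos_eq in HN by (apply pow_le; lra).
  unfold Rdiv in HN at 1. rewrite Rpow_mult_distr, pow_inv in HN.
  assert (PM : 0 < M ^ N) by now apply pow_lt.
  apply Rge_le in HN.
  apply (Rmult_le_compat_r (M ^ N)) in HN; [|lra].
  rewrite Rmult_assoc, Rinv_l, Rmult_1_r in HN by lra.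
  apply (Rmult_le_compat_r (Cmod I)) in HN; [|lra].
  replace ((K / Cmod I + 1) * M ^ N * Cmod I)
    with (K * M ^ N + M ^ N * Cmod I) in HN by (field; lra).
  assert (0 < M ^ N * Cmod I) by (apply Rmult_lt_0_compat; auto).
  lra.
- specialize (HK 1%nat). rewrite <- M0 in HK. simpl in HK.
  rewrite <- M0 in Hlt. nra.
Qed.

(** * Complex exponential and the damping kernel *)

Lemma exp_le (x y : R) : x <= y -> exp x <= exp y.
Proof. intros [H|H]; [left; now apply exp_increasing|right; now rewrite H]. Qed.

Lemma Cexp_plus (z w : C) : Cexp (z + w) = (Cexp z * Cexp w)%C.
Proof.
unfold Cexp. rewrite re_plus, im_plus, exp_plus, cos_plus, sin_plus.
apply injective_projections; simpl; ring.
Qed.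

Lemma Cmod_Cexp (z : C) : Cmod (Cexp z) = exp (Re z).
Proof.
unfold Cexp, Cmod; simpl.
replace (exp (Re z) * cos (Im z) * (exp (Re z) * cos (Im z) * 1)
  + exp (Re z) * sin (Im z) * (exp (Re z) * sin (Im z) * 1))
  with (exp (Re z) * exp (Re z) * (Rsqr (sin (Im z)) + Rsqr (cos (Im z))))
  by (unfold Rsqr; ring).
rewrite sin2_cos2, Rmult_1_r. apply sqrt_square. left; apply exp_pos.
Qed.

Lemma Cmod_Rcpow (x : R) (z : C) : Cmod (Rcpow x z) = Rpower x (Re z).
Proof. unfold Rcpow. rewrite Cmod_Cexp, re_scal_r. reflexivity. Qed.

(** The upper bound comes from exp(-x) >= 1 - x, that is exp(x) (1 - x) <= 1. *)
Lemma exp_second_order (x : R) : Rabs x <= 1 / 2 -> 0 <= exp x - 1 - x <= 2 * x ^ 2.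
Proof.
intros Hx. apply Rabs_le_between in Hx.
split; [generalize (exp_ineq1_le x); lra|].
assert (H := exp_ineq1_le (- x)). rewrite exp_Ropp in H.
assert (P := exp_pos x).
apply (Rmult_le_compat_r (exp x)) in H; [|lra].
rewrite Rinv_l in H by lra. nra.
Qed.

Lemma sin_abs_le (y : R) : Rabs (sin y) <= Rabs y.
Proof.
destruct (Rle_or_lt 0 y) as [H|H].
- rewrite (Rabs_pos_eq y) by auto. destruct (Rle_lt_or_eq_dec 0 y H) as [H'|<-].
  2:{ rewrite sin_0, Rabs_R0; lra. }
  apply Rabs_le; split.
  + destruct (Rle_or_lt y 1).
    * assert (0 < sin y); [|lra]. apply sin_gt_0; auto.
      generalize PI2_3_2; lra.
    * generalize (SIN_bound y); lra.
  + left; now apply sin_lt_x.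
- rewrite (Rabs_left y), <- Rabs_Ropp, <- sin_neg by auto.
  assert (H' : 0 < - y) by lra. set (u := - y) in *.
  apply Rabs_le; split.
  + destruct (Rle_or_lt u 1).
    * assert (0 < sin u); [|lra]. apply sin_gt_0; auto.
      generalize PI2_3_2; lra.
    * generalize (SIN_bound u); lra.
  + left; now apply sin_lt_x.
Qed.

Lemma cos_second_order (y : R) : 0 <= 1 - cos y <= y ^ 2 / 2.
Proof.
split; [generalize (COS_bound y); lra|].
replace y with (2 * (y / 2)) at 1 by field. rewrite cos_2a_sin.
assert (H := sin_abs_le (y / 2)).
apply Rsqr_le_abs_1 in H. unfold Rsqr in H. lra.
Qed.

Lemma sin_second_order (y : R) : Rabs y <= 1 -> Rabs (sin y - y) <= y ^ 2.
Proof.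
intros Hy.
destruct (MVT_gen (fun u => sin u - u) 0 y (fun u => cos u - 1)) as [c [Hc E]].
- intros x _. auto_derive; auto. ring.
- intros x _. apply continuity_pt_minus; [apply continuity_sin|apply continuity_pt_id].
- simpl in E. rewrite sin_0 in E. replace (sin y - y) with ((cos c - 1) * y) by lra.
  rewrite Rabs_mult.
  assert (Hcy : Rabs c <= Rabs y).
  { unfold Rmin, Rmax in Hc. destruct (Rle_dec 0 y).
    - rewrite !Rabs_pos_eq; lra.
    - rewrite !Rabs_left1; lra. }
  assert (H := cos_second_order c). rewrite (Rabs_left1 (cos c - 1)) by lra.
  rewrite <- (pow2_abs c) in H. rewrite <- (pow2_abs y).
  assert (0 <= Rabs c) by apply Rabs_pos. nra.
Qed.

(** Serves twice: for the derivative of [Cexp], and for the rate of convergence of Euler's limit. *)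
Lemma Cexp_second_order (w : C) :
  Cmod w <= 1 / 2 -> Cmod (Cexp w - 1 - w) <= 4 * Cmod w ^ 2.
Proof.
intros Hw. rewrite Cmod2_alt.
assert (Hx := re_le_Cmod w). assert (Hy := im_le_Cmod w).
set (x := Re w) in *. set (y := Im w) in *.
eapply Rle_trans; [apply Cmod_le_parts|].
replace (Re (Cexp w - 1 - w)) with ((exp x - 1 - x) + exp x * (cos y - 1))
  by (unfold Cminus; rewrite !re_plus, !re_opp, re_RtoC;
      change (Re (Cexp w)) with (exp x * cos y); fold x; ring).
replace (Im (Cexp w - 1 - w)) with ((exp x - 1) * sin y + (sin y - y))
  by (unfold Cminus; rewrite !im_plus, !im_opp, im_RtoC;
      change (Im (Cexp w)) with (exp x * sin y); fold y; ring).
assert (E := exp_second_order x ltac:(lra)).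
assert (E2 : Rabs (exp x - 1) <= 2 * Rabs x).
{ rewrite <- (pow2_abs x) in E. assert (0 <= Rabs x) by apply Rabs_pos.
  replace (exp x - 1) with ((exp x - 1 - x) + x) by ring.
  eapply Rle_trans; [apply Rabs_triang|]. rewrite (Rabs_pos_eq (exp x - 1 - x)) by lra.
  nra. }
assert (E3 : 0 < exp x <= 2).
{ split; [apply exp_pos|]. assert (A := Rle_abs (exp x - 1)). lra. }
assert (Cy := cos_second_order y).
assert (Sy := sin_second_order y ltac:(lra)).
assert (Sy' := sin_abs_le y).
assert (A1 : Rabs ((exp x - 1 - x) + exp x * (cos y - 1)) <= 2 * x ^ 2 + y ^ 2).
{ eapply Rle_trans; [apply Rabs_triang|].
  rewrite Rabs_mult, (Rabs_pos_eq (exp x - 1 - x)), (Rabs_pos_eq (exp x)),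
    (Rabs_left1 (cos y - 1)) by lra. nra. }
assert (A2 : Rabs ((exp x - 1) * sin y + (sin y - y)) <= 2 * (Rabs x * Rabs y) + y ^ 2).
{ eapply Rle_trans; [apply Rabs_triang|]. rewrite Rabs_mult.
  assert (Rabs (exp x - 1) * Rabs (sin y) <= 2 * Rabs x * Rabs y).
  { apply Rmult_le_compat; auto; apply Rabs_pos. }
  lra. }
assert (A3 : 2 * (Rabs x * Rabs y) <= x ^ 2 + y ^ 2).
{ rewrite <- (pow2_abs x), <- (pow2_abs y).
  assert (H := pow2_ge_0 (Rabs x - Rabs y)). nra. }
assert (0 <= x ^ 2) by apply pow2_ge_0. assert (0 <= y ^ 2) by apply pow2_ge_0.
lra.
Qed.

Lemma diff_at_Cexp (z : C) : diff_at Cexp z.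
Proof.
set (E := fun u => if Ceq_dec u 0 then RtoC 1 else ((Cexp u - 1) / u)%C).
exists (fun w => Cexp z * E (w - z))%C; split.
- apply (cont_at_mult (fun _ => Cexp z) (fun w => E (w - z)%C));
    [apply cont_at_const|].
  intros eps Heps. exists (Rmin (1 / 2) (eps / 4)); split; [apply Rmin_pos; lra|].
  intros w Hw.
  assert (M1 := Rmin_l (1 / 2) (eps / 4)). assert (M2 := Rmin_r (1 / 2) (eps / 4)).
  replace (z - z)%C with (RtoC 0) by ring.
  unfold E. destruct (Ceq_dec 0 0) as [_|N]; [|now elim N].
  destruct (Ceq_dec (w - z) 0) as [_|N].
  + replace (1 - 1)%C with (RtoC 0) by ring. now rewrite Cmod_0.
  + set (u := (w - z)%C) in *.
    assert (Hu := proj1 (Cmod_gt_0 u) N).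
    replace ((Cexp u - 1) / u - 1)%C with ((Cexp u - 1 - u) / u)%C by (field; auto).
    rewrite Cmod_div by auto. apply Rlt_div_l; auto.
    assert (H := Cexp_second_order u ltac:(lra)). nra.
- intros w. unfold E. destruct (Ceq_dec (w - z) 0) as [E0|N].
  + apply Ceq_minus in E0. rewrite E0. ring.
  + replace w with (z + (w - z))%C at 1 by ring. rewrite Cexp_plus. field. auto.
Qed.

(* [exp (- cos w)]: in the strip |Re w| <= 1 it decays doubly exponentially,
   which beats the growth of any entire function of finite order. *)
Definition kernel (w : C) : C :=
  Cexp (RtoC (- (1 / 2)) * (Cexp (Ci * w) + Cexp (- Ci * w))).

Lemma diff_at_linear (a b z : C) : diff_at (fun w => a * w + b)%C z.
Proof.
apply (diff_at_plus (fun w => a * w)%C (fun _ => b)); [|apply diff_at_const].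
apply (diff_at_mult (fun _ => a) (fun w => w)); [apply diff_at_const|apply diff_at_id].
Qed.

Lemma diff_at_Cexp_linear (a b z : C) : diff_at (fun w => Cexp (a * w + b))%C z.
Proof.
apply (diff_at_comp (fun w => a * w + b)%C Cexp);
  [apply diff_at_linear|apply diff_at_Cexp].
Qed.

Lemma diff_at_ext (f g : C -> C) (z : C) :
  (forall w, f w = g w) -> diff_at f z -> diff_at g z.
Proof. intros E. apply diff_at_ext_near with 1; [lra|auto]. Qed.

Lemma diff_at_kernel (z : C) : diff_at kernel z.
Proof.
apply (diff_at_comp (fun w => RtoC (- (1 / 2)) * (Cexp (Ci * w) + Cexp (- Ci * w)))%C Cexp);
  [|apply diff_at_Cexp].
apply (diff_at_mult (fun _ => RtoC (- (1 / 2)))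
         (fun w => Cexp (Ci * w) + Cexp (- Ci * w))%C); [apply diff_at_const|].
apply (diff_at_plus (fun w => Cexp (Ci * w)) (fun w => Cexp (- Ci * w)));
  [apply diff_at_ext with (fun w => Cexp (Ci * w + 0))
  |apply diff_at_ext with (fun w => Cexp (- Ci * w + 0))];
  try apply diff_at_Cexp_linear; intros w; f_equal; ring.
Qed.

(** The real part of cos(u + iv) is cos u cosh v. *)
Lemma Cmod_kernel (w : C) :
  Cmod (kernel w) = exp (- (cos (Re w) * (exp (Im w) + exp (- Im w)) / 2)).
Proof.
unfold kernel. rewrite Cmod_Cexp. f_equal.
destruct w as [u v]. unfold Cexp; simpl.
replace (0 * u - 1 * v) with (- v) by ring.
replace (- (0) * u - - (1) * v) with v by ring.
replace (0 * v + 1 * u) with u by ring.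
replace (- (0) * v + - (1) * u) with (- u) by ring.
rewrite cos_neg. field.
Qed.

Lemma kernel_0 : Cmod (kernel 0) = exp (- 1).
Proof.
rewrite Cmod_kernel. simpl. rewrite cos_0, Ropp_0, exp_0. f_equal. field.
Qed.

Lemma Cmod_kernel_le (w : C) :
  Rabs (Re w) <= 1 -> Cmod (kernel w) <= exp (- (exp (Rabs (Im w)) / 4)).
Proof.
intros Hu. rewrite Cmod_kernel. 
assert (Hc : 1 / 2 <= cos (Re w)).
{ assert (H := cos_second_order (Re w)). rewrite <- (pow2_abs (Re w)) in H.
  assert (0 <= Rabs (Re w)) by apply Rabs_pos. nra. }
assert (P1 := exp_pos (Im w)). assert (P2 := exp_pos (- Im w)).
assert (He : exp (Rabs (Im w)) <= exp (Im w) + exp (- Im w)).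
{ unfold Rabs. destruct (Rcase_abs (Im w)); lra. }
assert (Hle : - (cos (Re w) * (exp (Im w) + exp (- Im w)) / 2) <= - (exp (Rabs (Im w)) / 4))
  by nra.
now apply exp_le.
Qed.

(** * Comparisons of powers, logarithms and exponentials *)

Lemma Rpower_pos (x y : R) : 0 < Rpower x y.
Proof. apply exp_pos. Qed.

Lemma Rpower_ge_1 (x y : R) : 1 <= x -> 0 <= y -> 1 <= Rpower x y.
Proof.
intros Hx Hy. rewrite <- (Rpower_O x) by lra. now apply Rle_Rpower.
Qed.

Lemma ln_le_self (x : R) : 0 < x -> ln x <= x.
Proof. intros Hx. assert (H := exp_ineq1_le (ln x)). rewrite exp_ln in H; lra. Qed.

Lemma ln_ge_1 (x : R) : 3 <= x -> 1 <= ln x.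
Proof.
intros Hx. apply Rnot_lt_le; intros H. apply exp_increasing in H.
rewrite exp_ln in H by lra. generalize exp_le_3; lra.
Qed.

(** Shaped for the horizontal sides: (2x)^A is the logarithm of the finite-order bound, B ln x
    collects powers of the height, and the right side is the exponent of the damping kernel. From ln
    y <= y at y = x / (4 (A + 1)) one gets x^(A+1) <= D exp(x/4), and the spare factor x absorbs the
    constants. *)
Lemma exp_beats_powers (A B : R) : 1 <= A -> 0 <= B ->
  exists T, forall x, T <= x ->
    Rpower (2 * x) A + B * ln x <= exp (x / 4) / 4.
Proof.
intros HA HB.
set (D := Rpower (4 * (A + 1)) (A + 1)).
assert (HD : 0 < D) by apply Rpower_pos.
set (E := Rpower 2 A + B).
assert (HE : 0 < E) by (unfold E; generalize (Rpower_pos 2 A); lra).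
exists (1 + 4 * D * E). intros x Hx.
assert (Hx1 : 1 <= x) by (assert (0 < 4 * D * E) by (repeat apply Rmult_lt_0_compat; lra); lra).
assert (Hp : Rpower x (A + 1) <= D * exp (x / 4)).
{ replace x with ((4 * (A + 1)) * (x / (4 * (A + 1)))) at 1 by (field; lra).
  rewrite <- Rpower_mult_distr by (try apply Rdiv_lt_0_compat; lra).
  fold D. apply Rmult_le_compat_l; [lra|]. apply exp_le.
  assert (H := ln_le_self (x / (4 * (A + 1))) ltac:(apply Rdiv_lt_0_compat; lra)).
  apply Rle_trans with ((A + 1) * (x / (4 * (A + 1)))).
  - apply Rmult_le_compat_l; lra.
  - right; field; lra. }
rewrite Rpower_plus, Rpower_1 in Hp by lra.
rewrite <- Rpower_mult_distr by lra.
assert (Hln : ln x <= Rpower x A).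
{ apply Rle_trans with x; [apply ln_le_self; lra|].
  rewrite <- (Rpower_1 x) at 1 by lra. now apply Rle_Rpower. }
assert (HP := Rpower_pos x A).
assert (H1 : Rpower 2 A * Rpower x A + B * ln x <= E * Rpower x A) by (unfold E; nra).
assert (H2 : Rpower x A * (4 * D * E) <= D * exp (x / 4)).
{ eapply Rle_trans; [|exact Hp]. apply Rmult_le_compat_l; lra. }
apply Rmult_le_reg_l with (4 * D); [lra|].
apply Rle_trans with (Rpower x A * (4 * D * E)); [nra|lra].
Qed.

Lemma Rpower_near (x u e : R) : 0 < x -> x / 2 <= u <= 3 * x / 2 ->
  Rpower u e <= Rpower 2 (Rabs e) * Rpower x e.
Proof.
intros Hx Hu. replace u with (u / x * x) at 1 by (field; lra).
assert (Hp : 0 < u / x) by (apply Rdiv_lt_0_compat; lra).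
rewrite <- Rpower_mult_distr by auto.
apply Rmult_le_compat_r; [left; apply Rpower_pos|].
apply exp_le.
assert (Hl2 : 0 < ln 2) by (rewrite <- ln_1; apply ln_increasing; lra).
assert (Hl : Rabs (ln (u / x)) <= ln 2).
{ apply Rabs_le; split.
  - rewrite <- ln_Rinv by lra. apply ln_le; [lra|].
    apply Rle_div_r; lra.
  - apply ln_le; auto. apply Rle_div_l; lra. }
apply Rle_trans with (Rabs (e * ln (u / x))); [apply Rle_abs|].
rewrite Rabs_mult. apply Rmult_le_compat_l; [apply Rabs_pos|auto].
Qed.

(** For x >= 4 one has u <= x^2, hence ln u <= 2 ln x. *)
Lemma Rpower_ln_near (x u l : R) : 4 <= x -> 0 <= l -> x / 2 <= u <= 3 * x / 2 ->
  Rpower (ln u) l <= Rpower 2 l * Rpower (ln x) l.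
Proof.
intros Hx Hl Hu.
assert (H1 : 0 < ln u) by (rewrite <- ln_1; apply ln_increasing; lra).
assert (H2 : 0 < ln x) by (rewrite <- ln_1; apply ln_increasing; lra).
rewrite Rpower_mult_distr by lra.
apply Rle_Rpower_l; auto. split; auto.
replace (2 * ln x) with (ln (x * x)) by (rewrite ln_mult by lra; ring).
apply ln_le; nra.
Qed.

(** * The Phragmen-Lindelof principle *)

Lemma Rmult_le_compat3 (a b c a' b' c' : R) :
  0 <= a -> 0 <= b -> 0 <= c -> a <= a' -> b <= b' -> c <= c' ->
  a * b * c <= a' * b' * c'.
Proof.
intros. apply Rmult_le_compat; auto.
- now apply Rmult_le_pos.
- now apply Rmult_le_compat.
Qed.

(* The maximum principle is applied, around each s0 of large height tau, to
   G(s) kernel((s-s0)/2) tau^(-q(s-s0)): the last factor interpolates between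
   the two exponents and the kernel makes the horizontal sides negligible. *)
Theorem Phragmen_Lindelof (G : C -> C) (x0 x1 p q l : R) :
  (forall z, diff_at G z) -> finite_order G ->
  x0 <= x1 <= x0 + 2 -> 0 <= l ->
  (exists K T, forall t, T <= Rabs t ->
     Cmod (G (x0, t)) <= K * (Rpower (Rabs t) p * Rpower (ln (Rabs t)) l)) ->
  (exists K T, forall t, T <= Rabs t ->
     Cmod (G (x1, t)) <= K * (Rpower (Rabs t) (p + q * (x1 - x0))
                              * Rpower (ln (Rabs t)) l)) ->
  exists K T, forall s : C, T <= Rabs (Im s) -> x0 <= Re s <= x1 ->
    Cmod (G s) <= K * (Rpower (Rabs (Im s)) (p + q * (Re s - x0))
                       * Rpower (ln (Rabs (Im s))) l).
Proof.
intros HG [A [r0 [HA [Hr0 Hord]]]] Hx Hl [K0 [T0 H0]] [K1 [T1 H1]].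
set (A' := Rmax A 1). assert (HA1 := Rmax_l A 1). assert (HA2 := Rmax_r A 1).
fold A' in HA1, HA2.
(* On the horizontal sides the interpolating factor costs at most tau^(2|q|), and the target power
   is at least tau^(-|p| - 2|q|); B exceeds the total exponent |p| + 4|q|. *)
set (B := 2 * Rabs p + 6 * Rabs q).
assert (Pp := Rabs_pos p). assert (Pq := Rabs_pos q).
destruct (exp_beats_powers A' B HA2 ltac:(unfold B; lra)) as [T2 HT2].
set (Km := Rmax 1 (Rmax K0 K1)).
assert (Km1 : 1 <= Km) by apply Rmax_l.
assert (Km2 : K0 <= Km) by (eapply Rle_trans; [apply Rmax_l|apply Rmax_r]).
assert (Km3 : K1 <= Km) by (eapply Rle_trans; [apply Rmax_r|apply Rmax_r]).
set (c := Rpower 2 (Rabs p + 2 * Rabs q)).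
assert (Hc1 : 1 <= c) by (apply Rpower_ge_1; lra).
set (cl := Rpower 2 l).
assert (Hcl : 1 <= cl) by (apply Rpower_ge_1; lra).
set (M0 := Km * (c * cl)).
assert (Hccl : 1 <= c * cl) by nra.
assert (HM0 : Km <= M0) by (unfold M0; nra).
exists (exp 1 * M0).
(* The doubled terms make tau/2, the least height on the rectangle, exceed T0, T1 and r0, and keep
   the modulus below 3 tau/2 + |x0| + |x1| <= 2 tau. *)
exists (2 * Rabs T0 + 2 * Rabs T1 + Rabs T2 + 2 * Rabs r0 + 2 * Rabs x0 + 2 * Rabs x1 + 8).
intros s0 Hs0 Hre.
set (t0 := Im s0) in *. set (tau := Rabs t0) in *. set (a := Re s0) in *.
assert (PT0 := Rabs_pos T0). assert (PT1 := Rabs_pos T1). assert (PT2 := Rabs_pos T2).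
assert (Pr := Rabs_pos r0). assert (Px0 := Rabs_pos x0). assert (Px1 := Rabs_pos x1).
assert (LT0 := Rle_abs T0). assert (LT1 := Rle_abs T1). assert (LT2 := Rle_abs T2).
assert (Lr := Rle_abs r0).
assert (Htau : 8 <= tau) by lra.
set (Q := Rpower tau (p + q * (a - x0)) * Rpower (ln tau) l).
assert (HQ : 0 < Q) by (apply Rmult_lt_0_compat; apply Rpower_pos).
assert (He1 : 1 <= exp 1) by (generalize (exp_ineq1_le 1); lra).
assert (HKm : Km <= exp 1 * M0) by nra.
(* The maximum principle needs an interior point; on the two edges the hypotheses apply directly. *)
destruct (Req_dec a x0) as [E0|N0].
{ replace s0 with ((x0, t0) : C) by (rewrite <- E0; now destruct s0).
  eapply Rle_trans; [apply H0; fold tau; lra|]. fold tau.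
  replace (Rpower tau p) with (Rpower tau (p + q * (a - x0))) by (f_equal; rewrite E0; ring).
  fold Q. apply Rmult_le_compat_r; lra. }
destruct (Req_dec a x1) as [E1|N1].
{ replace s0 with ((x1, t0) : C) by (rewrite <- E1; now destruct s0).
  eapply Rle_trans; [apply H1; fold tau; lra|]. fold tau. rewrite <- E1. fold Q.
  apply Rmult_le_compat_r; lra. }
assert (Hax : x0 < a < x1) by lra.
(* The arguments are written as affine functions of s to match [diff_at_linear]; the last factor is
   tau^(- q (s - s0)). *)
pose (F := fun s => (G s * kernel (RtoC (1 / 2) * s + - (RtoC (1 / 2) * s0))
                     * Cexp ((- RtoC q * RtoC (ln tau)) * s
                             + RtoC q * RtoC (ln tau) * s0))%C).
assert (HF : forall z, diff_at F z).
{ intros z. apply (diff_at_mult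
    (fun s => G s * kernel (RtoC (1 / 2) * s + - (RtoC (1 / 2) * s0)))%C).
  - apply (diff_at_mult G); auto.
    apply (diff_at_comp (fun s => RtoC (1 / 2) * s + - (RtoC (1 / 2) * s0))%C kernel).
    + apply diff_at_linear.
    + apply diff_at_kernel.
  - apply diff_at_Cexp_linear. }
assert (HFm : forall s, Cmod (F s) =
  Cmod (G s) * Cmod (kernel (RtoC (1 / 2) * (s - s0))) * Rpower tau (- (q * (Re s - a)))).
{ intros s. unfold F. rewrite !Cmod_mult, Cmod_Cexp. f_equal; [f_equal; f_equal; f_equal; ring|].
  unfold Rpower. f_equal. unfold a. destruct s, s0; simpl; ring. }
(* The twist makes the exponent independent of x, so both vertical edges obey the same bound, with
   the exponent wanted at s0. *)
assert (HQ0 : forall x, Rpower tau (p + q * (x - x0)) * Rpower tau (- (q * (x - a)))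
   = Rpower tau (p + q * (a - x0))).
{ intros x. rewrite <- Rpower_plus. f_equal; ring. }
assert (Hk1 : forall s, x0 <= Re s <= x1 -> 
  Cmod (kernel (RtoC (1 / 2) * (s - s0))) <= exp (- (exp (Rabs (Im s - t0) / 2) / 4))).
{ intros s Hs. eapply Rle_trans; [apply Cmod_kernel_le|].
  - replace (Re (RtoC (1 / 2) * (s - s0))%C) with ((Re s - a) / 2)
      by (unfold a; destruct s, s0; simpl; field).
    apply Rabs_le; lra.
  - replace (Im (RtoC (1 / 2) * (s - s0))%C) with ((Im s - t0) * / 2)
      by (unfold t0; destruct s, s0; simpl; field).
    rewrite Rabs_mult, (Rabs_pos_eq (/ 2)) by lra. right; reflexivity. }
assert (Hk : forall s, x0 <= Re s <= x1 -> Cmod (kernel (RtoC (1 / 2) * (s - s0))) <= 1).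
{ intros s Hs. eapply Rle_trans; [apply Hk1; auto|]. rewrite <- exp_0. apply exp_le.
  generalize (exp_pos (Rabs (Im s - t0) / 2)); lra. }
assert (Habs : forall y, t0 - tau / 2 <= y <= t0 + tau / 2 ->
  tau / 2 <= Rabs y <= 3 * tau / 2).
{ intros y Hy. unfold tau in *. unfold Rabs in *.
  destruct (Rcase_abs t0), (Rcase_abs y); lra. }
assert (Hedge : forall x K y, x0 <= x <= x1 -> K <= Km ->
  t0 - tau / 2 <= y <= t0 + tau / 2 ->
  Cmod (G (x, y)) <= K * (Rpower (Rabs y) (p + q * (x - x0)) * Rpower (ln (Rabs y)) l) ->
  Cmod (F (x, y)) <= M0 * Q).
{ intros x K y Hx' HK Hy HGb. rewrite HFm. simpl Re.
  assert (Hy' := Habs y Hy).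
  apply Rle_trans with (Km * ((c * Rpower tau (p + q * (x - x0))) * (cl * Rpower (ln tau) l))
                        * 1 * Rpower tau (- (q * (x - a)))).
  2:{ right. unfold M0, Q. rewrite <- (HQ0 x). ring. }
  apply Rmult_le_compat3; try apply Cmod_ge_0; try (left; apply Rpower_pos); try lra.
  2:{ now apply (Hk (x, y)). }
  eapply Rle_trans; [apply HGb|].
  apply Rle_trans with (Km * (Rpower (Rabs y) (p + q * (x - x0)) * Rpower (ln (Rabs y)) l)).
  { apply Rmult_le_compat_r; auto. left; apply Rmult_lt_0_compat; apply Rpower_pos. }
  apply Rmult_le_compat_l; [lra|].
  apply Rmult_le_compat; try (left; apply Rpower_pos).
  - eapply Rle_trans; [apply (Rpower_near tau); [lra|exact Hy']|].
    apply Rmult_le_compat_r; [left; apply Rpower_pos|].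
    apply Rle_Rpower; [lra|].
    eapply Rle_trans; [apply Rabs_triang|]. rewrite Rabs_mult, (Rabs_pos_eq (x - x0)) by lra.
    nra.
  - apply Rpower_ln_near; try lra. }
assert (HFb : Cmod (F s0) <= M0 * Q).
{ apply (max_modulus_rect F x0 x1 (t0 - tau / 2) (t0 + tau / 2)); auto; fold a t0; try lra.
  intros z [[Hz Hzi]|[Hz Hzi]].
  2:{ destruct z as [zx zy]; simpl in *. destruct Hz as [E|E]; rewrite E in *.
    - apply (Hedge x0 K0); auto; try lra.
      replace (p + q * (x0 - x0)) with p by ring. apply H0.
      specialize (Habs zy Hzi). lra.
    - apply (Hedge x1 K1); auto; try lra. apply H1.
      specialize (Habs zy Hzi). lra. }
  assert (Hzi' : Rabs (Im z - t0) = tau / 2).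
  { destruct Hzi as [-> | ->].
    - replace (t0 - tau / 2 - t0) with (- (tau / 2)) by ring.
      rewrite Rabs_Ropp, Rabs_pos_eq; lra.
    - replace (t0 + tau / 2 - t0) with (tau / 2) by ring. rewrite Rabs_pos_eq; lra. }
  assert (Hzi2 : tau / 2 <= Rabs (Im z) <= 3 * tau / 2) by (apply Habs; lra).
  assert (HzC : tau / 2 <= Cmod z <= 2 * tau).
  { split.
    - eapply Rle_trans; [apply Hzi2|apply im_le_Cmod].
    - eapply Rle_trans; [apply Cmod_le_parts|].
      assert (Rabs (Re z) <= Rabs x0 + Rabs x1); [|lra].
      assert (L0 := Rle_abs (- x0)). rewrite Rabs_Ropp in L0.
      assert (L1 := Rle_abs x1). apply Rabs_le; lra. }
  rewrite HFm.
  assert (HGz : Cmod (G z) <= exp (Rpower (2 * tau) A')).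
  { eapply Rle_trans; [apply Hord; lra|]. apply exp_le.
    eapply Rle_trans; [apply (Rle_Rpower _ _ A'); lra|].
    apply Rle_Rpower_l; lra. }
  assert (Hln : 1 <= ln tau) by (apply ln_ge_1; lra).
  assert (Hq : Rpower tau (- (q * (Re z - a))) <= Rpower tau (2 * Rabs q)).
  { apply Rle_Rpower; [lra|].
    eapply Rle_trans; [apply Rle_abs|]. rewrite Rabs_Ropp, Rabs_mult, Rmult_comm.
    apply Rmult_le_compat_r; auto. apply Rabs_le; lra. }
  apply Rle_trans with (exp (Rpower (2 * tau) A') * exp (- (exp (tau / 4) / 4))
                        * Rpower tau (2 * Rabs q)).
  { apply Rmult_le_compat3; auto; try apply Cmod_ge_0; try (left; apply Rpower_pos).
    eapply Rle_trans; [apply Hk1; auto|]. rewrite Hzi'.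
    right. do 4 f_equal. field. }
  (* The kernel swallows the finite-order growth and still leaves a power of tau below every
     admissible target. *)
  apply Rle_trans with (Rpower tau (- (Rabs p + 2 * Rabs q))).
  { unfold Rpower at 2 3. rewrite <- !exp_plus. apply exp_le.
    specialize (HT2 tau ltac:(lra)). unfold B in HT2.
    assert (0 <= Rabs p * ln tau) by nra. assert (0 <= Rabs q * ln tau) by nra. lra. }
  apply Rle_trans with (Rpower tau (p + q * (a - x0))).
  { apply Rle_Rpower; [lra|].
    assert (L := Rle_abs (- (p + q * (a - x0)))). rewrite Rabs_Ropp in L.
    assert (L2 := Rabs_triang p (q * (a - x0))). rewrite Rabs_mult, (Rabs_pos_eq (a - x0)) in L2 by lra.
    nra. }
  assert (HL : 1 <= Rpower (ln tau) l) by now apply Rpower_ge_1.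
  assert (HR := Rpower_pos tau (p + q * (a - x0))).
  apply Rle_trans with Q; [unfold Q; nra|]. nra. }
(* At s0 the twist is 1 and the kernel is exp(-1), whence the factor exp(1) in the constant. *)
rewrite HFm in HFb. fold a in HFb.
replace (RtoC (1 / 2) * (s0 - s0))%C with (RtoC 0) in HFb by ring.
replace (- (q * (a - a))) with 0 in HFb by ring.
rewrite Rpower_O, kernel_0, Rmult_1_r in HFb by lra.
assert (Ee : exp (-1) * exp 1 = 1) by (rewrite <- exp_plus; replace (-1 + 1) with 0 by ring; apply exp_0).
apply (Rmult_le_compat_r (exp 1)) in HFb; [|lra].
rewrite Rmult_assoc, Ee, Rmult_1_r in HFb.
fold Q. lra.
Qed.

(** * Quotients of Gamma values at equal height *)

Lemma inv_telescope (n : nat) : (1 <= n)%nat ->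
  / INR (S n) ^ 2 <= / INR n - / INR (S n).
Proof.
intros Hn. apply le_INR in Hn. rewrite S_INR. simpl (INR 1) in Hn.
set (x := INR n) in *.
replace (/ x - / (x + 1)) with (/ (x * (x + 1))) by (field; lra).
apply Rinv_le_contravar; nra.
Qed.

(** By 1 + x <= exp x and the telescoping majorant of 1/n^2, the sequence r(n) exp(K/n) does not
    increase from N on. *)
Lemma growth_bounded (r : nat -> R) (K : R) (N : nat) :
  (1 <= N)%nat -> 0 <= K -> (forall n, 0 <= r n) ->
  (forall n, (N <= n)%nat -> r (S n) <= r n * (1 + K / INR (S n) ^ 2)) ->
  forall n, (N <= n)%nat -> r n <= r N * exp K.
Proof.
intros HN HK Hr Hs.
assert (H : forall k, r (N + k)%nat * exp (K / INR (N + k)) <= r N * exp (K / INR N)).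
{ induction k as [|k IH]; [rewrite Nat.add_0_r; lra|].
  eapply Rle_trans; [|exact IH]. rewrite Nat.add_succ_r.
  set (m := (N + k)%nat).
  assert (T := inv_telescope m ltac:(lia)).
  apply Rle_trans with (r m * (1 + K / INR (S m) ^ 2) * exp (K / INR (S m))).
  { apply Rmult_le_compat_r; [left; apply exp_pos|]. apply Hs. lia. }
  rewrite Rmult_assoc. apply Rmult_le_compat_l; auto.
  apply Rle_trans with (exp (K / INR (S m) ^ 2) * exp (K / INR (S m))).
  { apply Rmult_le_compat_r; [left; apply exp_pos|]. apply exp_ineq1_le. }
  rewrite <- exp_plus. apply exp_le. unfold Rdiv. nra. }
intros n Hn. specialize (H (n - N)%nat).
replace (N + (n - N))%nat with n in H by lia.
assert (Hi : forall m, (1 <= m)%nat -> 0 <= K / INR m <= K).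
{ intros m Hm. apply le_INR in Hm. simpl (INR 1) in Hm. split.
  - apply Rmult_le_pos; auto. left; apply Rinv_0_lt_compat; lra.
  - apply Rle_div_l; [lra|]. nra. }
assert (E1 : 1 <= exp (K / INR n)).
{ rewrite <- exp_0 at 1. apply exp_le, Hi. lia. }
assert (E2 : exp (K / INR N) <= exp K) by (apply exp_le, Hi; auto).
specialize (Hr n) as Hrn. specialize (Hr N) as HrN.
apply Rle_trans with (r n * exp (K / INR n)); [nra|].
eapply Rle_trans; [exact H|]. now apply Rmult_le_compat_l.
Qed.

Lemma square_summable_increments_cv (u : nat -> R) (K : R) (N : nat) :
  (1 <= N)%nat -> 0 <= K ->
  (forall n, (N <= n)%nat -> Rabs (u (S n) - u n) <= K / INR (S n) ^ 2) ->
  ex_finite_lim_seq u.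
Proof.
intros HN HK Hs.
assert (H : forall n k, (N <= n)%nat ->
  Rabs (u (n + k)%nat - u n) <= K * (/ INR n - / INR (n + k))).
{ intros n k Hn. induction k as [|k IH].
  - rewrite Nat.add_0_r, !Rminus_diag, Rabs_R0. lra.
  - rewrite Nat.add_succ_r. set (m := (n + k)%nat) in *.
    replace (u (S m) - u n) with ((u (S m) - u m) + (u m - u n)) by ring.
    eapply Rle_trans; [apply Rabs_triang|].
    specialize (Hs m ltac:(lia)). assert (T := inv_telescope m ltac:(lia)).
    unfold Rdiv in Hs. nra. }
assert (H2 : forall n m, (N <= n <= m)%nat -> Rabs (u m - u n) <= K / INR n).
{ intros n m Hnm. specialize (H n (m - n)%nat ltac:(lia)).
  replace (n + (m - n))%nat with m in H by lia.
  eapply Rle_trans; [exact H|]. unfold Rdiv. apply Rmult_le_compat_l; auto.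
  assert (0 < / INR m); [|lra]. apply Rinv_0_lt_compat, lt_0_INR. lia. }
apply ex_lim_seq_cauchy_corr. intros eps.
destruct (archimed_cor1 (eps / (K + 1))) as [M [HM HM0]].
{ apply Rdiv_lt_0_compat; [apply cond_pos|lra]. }
exists (N + M)%nat.
assert (K2 : forall n m, (N + M <= n)%nat -> (N + M <= m)%nat -> (n <= m)%nat ->
  Rabs (u m - u n) < eps).
{ intros n m Hn Hm Hnm. eapply Rle_lt_trans; [apply H2; lia|].
  assert (Hi : / INR n <= / INR M).
  { apply Rinv_le_contravar; [apply lt_0_INR; lia|apply le_INR; lia]. }
  apply Rlt_div_r in HM; [|lra].
  assert (0 < / INR n) by (apply Rinv_0_lt_compat, lt_0_INR; lia).
  unfold Rdiv. nra. }
intros n m Hn Hm. destruct (Nat.le_ge_cases n m).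
- rewrite Rabs_minus_sym. auto.
- auto.
Qed.

(** * Convergence of Euler's limit off the real axis *)

Lemma Cmod_lim (w : nat -> C) (l : C) :
  is_lim_seq (fun n => Re (w n)) (Re l) -> is_lim_seq (fun n => Im (w n)) (Im l) ->
  is_lim_seq (fun n => Cmod (w n)) (Cmod l).
Proof.
intros H1 H2.
assert (E : forall z : C, Cmod z = sqrt (Re z * Re z + Im z * Im z)).
{ intros z. unfold Cmod. f_equal. unfold Re, Im. ring. }
rewrite E. apply is_lim_seq_ext with (fun n => sqrt (Re (w n) * Re (w n) + Im (w n) * Im (w n))).
{ intros n. now rewrite E. }
apply (is_lim_seq_continuous sqrt).
- apply continuity_pt_sqrt. nra.
- apply (is_lim_seq_plus' _ _ (Re l * Re l) (Im l * Im l)); now apply is_lim_seq_mult'.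
Qed.

Lemma Cprod_app1 (k : list C) (a : C) : Cprod (k ++ a :: nil) = (Cprod k * a)%C.
Proof.
induction k as [|b k IH]; simpl; [ring|]. rewrite IH. ring.
Qed.

Definition Gamma_den (z : C) (n : nat) : C :=
  Cprod (map (fun k => z + RtoC (INR k))%C (seq 0 (S n))).

Lemma Gamma_den_S (z : C) (n : nat) :
  Gamma_den z (S n) = (Gamma_den z n * (z + RtoC (INR (S n))))%C.
Proof.
unfold Gamma_den. rewrite (seq_S (S n) 0), map_app. simpl map at 2.
now rewrite Cprod_app1.
Qed.

Lemma shift_neq_0 (z : C) (r : R) : Im z <> 0 -> (z + RtoC r)%C <> RtoC 0.
Proof.
intros Hz E. apply Hz. apply (f_equal Im) in E. rewrite im_plus, !im_RtoC in E. lra.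
Qed.

Lemma Gamma_den_neq_0 (z : C) (n : nat) : Im z <> 0 -> Gamma_den z n <> RtoC 0.
Proof.
intros Hz. induction n as [|n IH].
- unfold Gamma_den; simpl. rewrite Cmult_1_r. apply (shift_neq_0 z 0 Hz).
- rewrite Gamma_den_S. apply Cmult_neq_0; auto. now apply shift_neq_0.
Qed.

Lemma Cexp_neq_0 (z : C) : Cexp z <> RtoC 0.
Proof.
apply Cmod_gt_0. rewrite Cmod_Cexp. apply exp_pos.
Qed.

Lemma Gamma_approx_neq_0 (z : C) (n : nat) : Im z <> 0 -> Gamma_approx z n <> RtoC 0.
Proof.
intros Hz. unfold Gamma_approx. fold (Gamma_den z n).
apply Cmult_neq_0; [apply Cmult_neq_0; [|apply Cexp_neq_0]|].
- intros E. apply RtoC_inj in E. now apply (INR_fact_neq_0 n).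
- apply Cmod_gt_0. rewrite Cmod_inv by now apply Gamma_den_neq_0.
  apply Rinv_0_lt_compat, Cmod_gt_0. now apply Gamma_den_neq_0.
Qed.

(** This also holds at n = 0, where the default value of [ln 0] cancels. *)
Lemma Gamma_approx_S (z : C) (n : nat) : Im z <> 0 ->
  Gamma_approx z (S n)
  = (Gamma_approx z n * (Cexp (z * RtoC (ln (INR (S n)) - ln (INR n)))
       * (RtoC (INR (S n)) / (z + RtoC (INR (S n))))))%C.
Proof.
intros Hz. unfold Gamma_approx. fold (Gamma_den z n). fold (Gamma_den z (S n)).
rewrite Gamma_den_S, fact_simpl, mult_INR, RtoC_mult.
unfold Rcpow.
replace (z * RtoC (ln (INR (S n))))%C
  with (z * RtoC (ln (INR n)) + z * RtoC (ln (INR (S n)) - ln (INR n)))%C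
  by (rewrite RtoC_minus; ring).
rewrite Cexp_plus. field. split.
- now apply shift_neq_0.
- now apply Gamma_den_neq_0.
Qed.

(** Put t = ln(1 + 1/n) and s = 1/(n+1). The ratio is exp(zt) / (1 + zs), and s <= t <= 1/n makes
    the first-order terms cancel up to O(n^-2). The lower bound on n ensures |zt| <= 1/2 and |z + n
    + 1| >= (n+1)/2. *)
Lemma Gamma_ratio_error (z : C) (n : nat) :
  Im z <> 0 -> 2 * Cmod z + 1 <= INR n ->
  Cmod (Cexp (z * RtoC (ln (INR (S n)) - ln (INR n)))
        * (RtoC (INR (S n)) / (z + RtoC (INR (S n)))) - 1)
  <= (32 * Cmod z ^ 2 + 4 * Cmod z) / INR (S n) ^ 2.
Proof.
intros Hz Hn. assert (Pz := Cmod_ge_0 z).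
rewrite S_INR. set (x := INR n) in *. set (t := ln (x + 1) - ln x).
assert (Hx : 1 <= x) by lra.
assert (Ht1 : t <= / x).
{ unfold t. rewrite <- ln_div by lra.
  assert (H := exp_ineq1_le (ln ((x + 1) / x))).
  rewrite exp_ln in H by (apply Rdiv_lt_0_compat; lra).
  replace ((x + 1) / x) with (1 + / x) in H at 2 by (field; lra). lra. }
assert (Ht2 : / (x + 1) <= t).
{ unfold t. replace (ln (x + 1) - ln x) with (- (ln x - ln (x + 1))) by ring.
  rewrite <- ln_div by lra.
  assert (H := exp_ineq1_le (ln (x / (x + 1)))).
  rewrite exp_ln in H by (apply Rdiv_lt_0_compat; lra).
  replace (x / (x + 1)) with (1 - / (x + 1)) in H at 2 by (field; lra). lra. }
set (s := / (x + 1)) in *.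
assert (Hs : 0 < s) by (apply Rinv_0_lt_compat; lra).
assert (Hxs : / x <= 2 * s).
{ unfold s. replace (2 * / (x + 1)) with (/ ((x + 1) / 2)) by (field; lra).
  apply Rinv_le_contravar; lra. }
assert (Hts : t - s <= 2 * s ^ 2).
{ apply Rle_trans with (/ x - s); [lra|].
  replace (/ x - s) with (/ x * s) by (unfold s; field; lra). nra. }
assert (Hsx : s * (x + 1) = 1) by (unfold s; field; lra).
assert (Hzt : Cmod (z * RtoC t) <= 1 / 2).
{ rewrite Cmod_mult, Cmod_R, Rabs_pos_eq by lra.
  assert (Hix : / x * x = 1) by (field; lra).
  assert (0 < / x) by (apply Rinv_0_lt_compat; lra). nra. }
assert (Hden : (x + 1) / 2 <= Cmod (z + RtoC (x + 1))).
{ assert (T := Cmod_triangle (z + RtoC (x + 1)) (- z)).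
  replace (z + RtoC (x + 1) + - z)%C with (RtoC (x + 1)) in T by ring.
  rewrite Cmod_R, Cmod_opp, Rabs_pos_eq in T by lra. lra. }
assert (Hn0 := shift_neq_0 z (x + 1) Hz).
assert (Hx0 : RtoC (x + 1) <> RtoC 0) by (intros E; apply RtoC_inj in E; lra).
replace (Cexp (z * RtoC t) * (RtoC (x + 1) / (z + RtoC (x + 1))) - 1)%C
  with (((Cexp (z * RtoC t) - 1 - z * RtoC t) + z * RtoC (t - s))
        * (RtoC (x + 1) / (z + RtoC (x + 1))))%C.
2:{ rewrite RtoC_minus. unfold s. rewrite RtoC_inv by lra. field. auto. }
rewrite Cmod_mult, Cmod_div, Cmod_R, (Rabs_pos_eq (x + 1)) by (auto; lra).
assert (A1 : Cmod ((Cexp (z * RtoC t) - 1 - z * RtoC t) + z * RtoC (t - s))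
             <= 16 * Cmod z ^ 2 * s ^ 2 + 2 * Cmod z * s ^ 2).
{ eapply Rle_trans; [apply Cmod_triangle|]. apply Rplus_le_compat.
  - eapply Rle_trans; [now apply Cexp_second_order|].
    rewrite Cmod_mult, Cmod_R, Rabs_pos_eq by lra.
    rewrite Rpow_mult_distr.
    assert (t ^ 2 <= (2 * s) ^ 2) by (apply pow_incr; lra).
    assert (0 <= Cmod z ^ 2) by apply pow2_ge_0. nra.
  - rewrite Cmod_mult, Cmod_R, Rabs_pos_eq by lra. nra. }
assert (A2 : (x + 1) / Cmod (z + RtoC (x + 1)) <= 2) by (apply Rle_div_l; lra).
apply Rle_trans with ((16 * Cmod z ^ 2 * s ^ 2 + 2 * Cmod z * s ^ 2) * 2).
- apply Rmult_le_compat; auto; try apply Cmod_ge_0.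
  left; apply Rdiv_lt_0_compat; lra.
- right. unfold s. field. lra.
Qed.

(** Convergence makes the [Lim_seq] values in [Gamma] genuine limits; non-vanishing is what allows
    division by Gamma factors in the functional equation. Both follow from w(n+1) = w(n) (1 + e(n))
    with e(n) = O(n^-2): [growth_bounded] is applied to |w(n)| and to its inverse. *)
Lemma Gamma_approx_cv (z : C) : Im z <> 0 ->
  is_lim_seq (fun n => Re (Gamma_approx z n)) (Re (Gamma z)) /\
  is_lim_seq (fun n => Im (Gamma_approx z n)) (Im (Gamma z)) /\
  Gamma z <> RtoC 0.
Proof.
intros Hz.
set (w := Gamma_approx z).
set (e := fun n => (Cexp (z * RtoC (ln (INR (S n)) - ln (INR n)))
            * (RtoC (INR (S n)) / (z + RtoC (INR (S n)))) - 1)%C).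
assert (Hw : forall n, w (S n) = (w n * (1 + e n))%C).
{ intros n. unfold w, e. rewrite (Gamma_approx_S z n Hz). ring. }
set (K := 32 * Cmod z ^ 2 + 4 * Cmod z).
assert (Pz := Cmod_ge_0 z).
assert (HK : 0 <= K) by (unfold K; assert (0 <= Cmod z ^ 2) by apply pow2_ge_0; lra).
(* The term 2K forces |e(n)| <= 1/2, so that 1 / (1 - |e|) <= 1 + 2|e|; this is where exp(2K) below
   comes from. *)
destruct (INR_unbounded (2 * Cmod z + 1 + 2 * K)) as [N HN].
assert (HN1 : (1 <= N)%nat).
{ apply INR_le. simpl. lra. }
assert (He : forall n, (N <= n)%nat -> Cmod (e n) <= K / INR (S n) ^ 2 /\ Cmod (e n) <= 1 / 2).
{ intros n Hn. apply le_INR in Hn.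
  assert (H1 : Cmod (e n) <= K / INR (S n) ^ 2) by (apply Gamma_ratio_error; auto; lra).
  split; auto. eapply Rle_trans; [exact H1|].
  rewrite S_INR. apply Rle_div_l; [apply pow_lt; lra|]. nra. }
assert (Hb : forall n, (N <= n)%nat -> Cmod (w n) <= Cmod (w N) * exp K).
{ apply (growth_bounded (fun n => Cmod (w n))); auto; [intros; apply Cmod_ge_0|].
  intros n Hn. rewrite Hw, Cmod_mult. apply Rmult_le_compat_l; [apply Cmod_ge_0|].
  eapply Rle_trans; [apply Cmod_triangle|]. rewrite Cmod_1.
  apply Rplus_le_compat_l, He; auto. }
assert (Hwn : forall n, 0 < Cmod (w n)).
{ intros n. now apply Cmod_gt_0, Gamma_approx_neq_0. }
assert (Hb' : forall n, (N <= n)%nat -> / Cmod (w n) <= / Cmod (w N) * exp (2 * K)).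
{ apply (growth_bounded (fun n => / Cmod (w n))); auto; [lra| |].
  - intros n; left; now apply Rinv_0_lt_compat.
  - intros n Hn. rewrite Hw, Cmod_mult.
    destruct (He n Hn) as [He1 He2]. assert (Pe := Cmod_ge_0 (e n)).
    assert (H1 : 1 - Cmod (e n) <= Cmod (1 + e n)%C).
    { assert (T := Cmod_triangle (1 + e n) (- e n)).
      replace (1 + e n + - e n)%C with (RtoC 1) in T by ring.
      rewrite Cmod_1, Cmod_opp in T. lra. }
    rewrite Rinv_mult. apply Rmult_le_compat_l; [left; now apply Rinv_0_lt_compat|].
    apply Rle_trans with (/ (1 - Cmod (e n))).
    { apply Rinv_le_contravar; lra. }
    apply Rle_trans with (1 + 2 * Cmod (e n)).
    + apply Rmult_le_reg_l with (1 - Cmod (e n)); [lra|]. rewrite Rinv_r by lra. nra.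
    + unfold Rdiv in *. lra. }
assert (Hinc : forall n, (N <= n)%nat ->
  Cmod (w (S n) - w n)%C <= (Cmod (w N) * exp K * K) / INR (S n) ^ 2).
{ intros n Hn. rewrite Hw. replace (w n * (1 + e n) - w n)%C with (w n * e n)%C by ring.
  rewrite Cmod_mult. unfold Rdiv. rewrite Rmult_assoc.
  apply Rmult_le_compat; try apply Cmod_ge_0; auto. now apply He. }
assert (HKK : 0 <= Cmod (w N) * exp K * K).
{ apply Rmult_le_pos; auto. apply Rmult_le_pos; [apply Cmod_ge_0|left; apply exp_pos]. }
assert (L1 : ex_finite_lim_seq (fun n => Re (w n))).
{ apply square_summable_increments_cv with (Cmod (w N) * exp K * K) N; auto.
  intros n Hn. eapply Rle_trans; [|now apply Hinc].
  apply (re_le_Cmod (w (S n) - w n)). }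
assert (L2 : ex_finite_lim_seq (fun n => Im (w n))).
{ apply square_summable_increments_cv with (Cmod (w N) * exp K * K) N; auto.
  intros n Hn. eapply Rle_trans; [|now apply Hinc].
  apply (im_le_Cmod (w (S n) - w n)). }
assert (L1' : is_lim_seq (fun n => Re (w n)) (Re (Gamma z))).
{ apply Lim_seq_correct' in L1. exact L1. }
assert (L2' : is_lim_seq (fun n => Im (w n)) (Im (Gamma z))).
{ apply Lim_seq_correct' in L2. exact L2. }
split; [exact L1'|split; [exact L2'|]].
apply Cmod_gt_0.
set (m := / (/ Cmod (w N) * exp (2 * K))).
assert (Pm : 0 < / Cmod (w N) * exp (2 * K)).
{ apply Rmult_lt_0_compat; [now apply Rinv_0_lt_compat|apply exp_pos]. }
apply Rlt_le_trans with m; [now apply Rinv_0_lt_compat|].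
apply (is_lim_seq_le_loc (fun _ => m) (fun n => Cmod (w n)) m (Cmod (Gamma z))).
- exists N. intros n Hn. unfold m. rewrite <- (Rinv_inv (Cmod (w n))).
  apply Rinv_le_contravar; [now apply Rinv_0_lt_compat|auto].
- apply is_lim_seq_const.
- now apply Cmod_lim.
Qed.

(** * Uniform comparison of Gamma at two real parts *)

(** Here h(u) = ln |u + iy|. Its change over length x1 - x2 is compared with x1 - x2 times its
    change over a unit step, because the latter telescopes in k. By the mean value theorem the
    discrepancy is one of values of h' at nearby points, and |h''| <= 1/(u^2 + y^2) = O((k+1)^-2)
    uniformly in y. *)
Lemma log_modulus_step (M x1 x2 y : R) (k : nat) :
  1 <= M -> Rabs x1 <= M -> Rabs x2 <= M -> x2 <= x1 -> 2 * M <= Rabs y ->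
  let h := fun u => ln (u ^ 2 + y ^ 2) / 2 in
  h (x2 + INR k) - h (x1 + INR k)
  <= (x1 - x2) * (h (INR k) - h (INR (S k))) + 128 * M ^ 2 / INR (S k) ^ 2.
Proof.
intros HM H1 H2 H12 Hy h.
assert (Py : 0 < y ^ 2) by (rewrite <- pow2_abs; apply pow_lt; lra).
assert (Ppos : forall u, 0 < u ^ 2 + y ^ 2).
{ intros u. assert (0 <= u ^ 2) by apply pow2_ge_0. lra. }
apply Rabs_le_between in H1. apply Rabs_le_between in H2.
pose (g := fun u => u / (u ^ 2 + y ^ 2)).
assert (Dh : forall u, is_derive h u (g u)).
{ intros u. unfold h, g. auto_derive; [apply Ppos|].
  field. specialize (Ppos u). lra. }
assert (Dg : forall u, is_derive g u ((y ^ 2 - u ^ 2) / (u ^ 2 + y ^ 2) ^ 2)).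
{ intros u. unfold g. auto_derive; [specialize (Ppos u); lra|].
  field. specialize (Ppos u). lra. }
assert (Pk := pos_INR k). rewrite S_INR. set (x := INR k) in *.
assert (mvt : forall a b, a <= b -> exists c, a <= c <= b /\ h b - h a = g c * (b - a)).
{ intros a b Hab. destruct (MVT_gen h a b g) as [c [Hc E]].
  - intros; apply Dh.
  - intros u _. apply continuity_pt_filterlim, (ex_derive_continuous h). eexists; apply Dh.
  - rewrite Rmin_left, Rmax_right in Hc by auto. now exists c. }
assert (Lg : forall u v, x - M <= u -> x - M <= v -> Rabs (u - v) <= 2 * M + 1 ->
  g u - g v <= 16 * (2 * M + 1) / (x + 1) ^ 2).
{ intros u v Hu Hv Huv. destruct (MVT_gen g v u (fun u => (y ^ 2 - u ^ 2) / (u ^ 2 + y ^ 2) ^ 2)) as [c [Hc E]].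
  - intros; apply Dg.
  - intros a _. apply continuity_pt_filterlim, (ex_derive_continuous g). eexists; apply Dg.
  - rewrite E.
    assert (Hcx : x - M <= c).
    { eapply Rle_trans; [|apply Hc]. apply Rmin_glb; auto. }
    (* For small k the term y^2 suffices, since |y| >= 2M; for k > 2M the point c >= k - M is itself
       comparable to k. *)
    assert (Hden : (x + 1) ^ 2 / 16 <= c ^ 2 + y ^ 2).
    { rewrite <- (pow2_abs y). destruct (Rle_or_lt x (2 * M)).
      - assert (0 <= c ^ 2) by apply pow2_ge_0.
        assert ((x + 1) ^ 2 <= (4 * Rabs y) ^ 2) by (apply pow_incr; lra). lra.
      - assert (0 <= Rabs y ^ 2) by apply pow2_ge_0.
        assert ((x + 1) ^ 2 <= (4 * c) ^ 2) by (apply pow_incr; lra). lra. }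
    assert (Hx2 : 0 < (x + 1) ^ 2) by (apply pow_lt; lra).
    assert (Hg : Rabs ((y ^ 2 - c ^ 2) / (c ^ 2 + y ^ 2) ^ 2) <= 16 / (x + 1) ^ 2).
    { assert (Pc := Ppos c).
      unfold Rdiv at 1. rewrite Rabs_mult, (Rabs_pos_eq (/ _))
        by (left; apply Rinv_0_lt_compat, pow_lt; lra).
      apply Rle_trans with ((c ^ 2 + y ^ 2) * / (c ^ 2 + y ^ 2) ^ 2).
      - apply Rmult_le_compat_r; [left; apply Rinv_0_lt_compat, pow_lt; lra|].
        assert (0 <= c ^ 2) by apply pow2_ge_0. apply Rabs_le; lra.
      - replace ((c ^ 2 + y ^ 2) * / (c ^ 2 + y ^ 2) ^ 2) with (/ (c ^ 2 + y ^ 2)) by (field; lra).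
        replace (16 / (x + 1) ^ 2) with (/ ((x + 1) ^ 2 / 16)) by (field; lra).
        apply Rinv_le_contravar; lra. }
    eapply Rle_trans; [apply Rle_abs|]. rewrite Rabs_mult.
    replace (16 * (2 * M + 1) / (x + 1) ^ 2) with (16 / (x + 1) ^ 2 * (2 * M + 1))
      by (field; lra).
    apply Rmult_le_compat; auto; apply Rabs_pos. }
destruct (mvt (x2 + x) (x1 + x)) as [c [Hc Ec]]; [lra|].
destruct (mvt x (x + 1)) as [c' [Hc' Ec']]; [lra|].
assert (Hd := Lg c' c ltac:(lra) ltac:(lra) ltac:(apply Rabs_le; lra)).
replace (h (x2 + x) - h (x1 + x)) with (- (g c * (x1 - x2))) by lra.
replace (h x - h (x + 1)) with (- g c') by lra.
apply Rle_trans with ((x1 - x2) * - g c' + (x1 - x2) * (16 * (2 * M + 1) / (x + 1) ^ 2)).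
- nra.
- apply Rplus_le_compat_l.
  assert (Hx2 : 0 < / (x + 1) ^ 2) by (apply Rinv_0_lt_compat, pow_lt; lra).
  unfold Rdiv. rewrite <- Rmult_assoc. apply Rmult_le_compat_r; nra.
Qed.

Lemma Cmod_log (x y : R) : y <> 0 -> Cmod (x, y) = exp (ln (x ^ 2 + y ^ 2) / 2).
Proof.
intros Hy.
assert (Py : 0 < x ^ 2 + y ^ 2).
{ assert (0 <= x ^ 2) by apply pow2_ge_0.
  assert (0 < y ^ 2); [|lra]. rewrite <- pow2_abs. apply pow_lt. now apply Rabs_pos_lt. }
unfold Cmod. simpl fst; simpl snd. rewrite <- Rpower_sqrt by auto.
unfold Rpower. f_equal. field.
Qed.

(** The main terms of [log_modulus_step] telescope, and 2 - 1/(n+1) is the inductive majorant of the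
    sum of 1/k^2. The term h(0) = ln |y| yields the power of |y|. *)
Lemma Gamma_den_ratio (M x1 x2 y : R) (n : nat) :
  1 <= M -> Rabs x1 <= M -> Rabs x2 <= M -> x2 <= x1 -> 2 * M <= Rabs y ->
  let h := fun u => ln (u ^ 2 + y ^ 2) / 2 in
  Cmod (Gamma_den (x2, y) n) <= Cmod (Gamma_den (x1, y) n)
    * exp ((x1 - x2) * (h 0 - h (INR (S n))) + 128 * M ^ 2 * (2 - / INR (S n))).
Proof.
intros HM H1 H2 H12 Hy h.
assert (Hy0 : y <> 0) by (intros E; rewrite E, Rabs_R0 in Hy; lra).
assert (HM2 : 0 <= 128 * M ^ 2) by nra.
assert (step : forall k, Cmod ((x2, y) + RtoC (INR k))%C <=
  Cmod ((x1, y) + RtoC (INR k))%C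
   * exp ((x1 - x2) * (h (INR k) - h (INR (S k))) + 128 * M ^ 2 / INR (S k) ^ 2)).
{ intros k.
  assert (E : forall x, ((x, y) + RtoC (INR k))%C = (x + INR k, y))
    by (intros; apply injective_projections; simpl; ring).
  rewrite !E, !Cmod_log by auto. rewrite <- exp_plus. apply exp_le.
  assert (H := log_modulus_step M x1 x2 y k HM H1 H2 H12 Hy). simpl in H.
  unfold h. simpl. lra. }
induction n as [|n IH].
- unfold Gamma_den. simpl map. simpl Cprod. rewrite !Cmult_1_r.
  eapply Rle_trans; [apply (step 0%nat)|]. simpl INR.
  apply Rmult_le_compat_l; [apply Cmod_ge_0|]. apply exp_le. lra.
- rewrite !Gamma_den_S, !Cmod_mult.
  eapply Rle_trans; [apply Rmult_le_compat; [apply Cmod_ge_0|apply Cmod_ge_0|exact IH|apply step]|].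
  set (A := Cmod (Gamma_den (x1, y) n)). set (B := Cmod ((x1, y) + RtoC (INR (S n)))%C).
  match goal with |- A * exp ?u * (B * exp ?v) <= _ =>
    replace (A * exp u * (B * exp v)) with (A * B * exp (u + v)) by (rewrite exp_plus; ring) end.
  apply Rmult_le_compat_l; [apply Rmult_le_pos; apply Cmod_ge_0|]. apply exp_le.
  assert (T := inv_telescope (S n) ltac:(lia)). unfold Rdiv. nra.
Qed.

(* Only quotients of Gamma values with equal imaginary part occur, so the
   factor exp(-pi|y|/2) of Stirling's formula is never needed. *)
Lemma Gamma_ratio (M : R) : 1 <= M -> exists K, 0 < K /\ forall x1 x2 y,
  Rabs x1 <= M -> Rabs x2 <= M -> x2 <= x1 -> 2 * M <= Rabs y ->
  Cmod (Gamma (x1, y)) <= K * Rpower (Rabs y) (x1 - x2) * Cmod (Gamma (x2, y)).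
Proof.
intros HM. exists (exp (256 * M ^ 2)). split; [apply exp_pos|].
intros x1 x2 y H1 H2 H12 Hy.
assert (Hy0 : y <> 0) by (intros E; rewrite E, Rabs_R0 in Hy; lra).
destruct (Gamma_approx_cv (x1, y) Hy0) as [A1 [A2 _]].
destruct (Gamma_approx_cv (x2, y) Hy0) as [B1 [B2 _]].
set (c := exp (256 * M ^ 2) * Rpower (Rabs y) (x1 - x2)).
apply (is_lim_seq_le_loc (fun n => Cmod (Gamma_approx (x1, y) n))
         (fun n => c * Cmod (Gamma_approx (x2, y) n))
         (Cmod (Gamma (x1, y))) (c * Cmod (Gamma (x2, y)))).
- exists 1%nat. intros n Hn. unfold Gamma_approx.
  fold (Gamma_den (x1, y) n). fold (Gamma_den (x2, y) n).
  assert (D1 := Gamma_den_neq_0 (x1, y) n Hy0).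
  assert (D2 := Gamma_den_neq_0 (x2, y) n Hy0).
  rewrite !Cmod_div, !Cmod_mult, !Cmod_Rcpow by auto. simpl Re.
  set (F := Cmod (RtoC (INR (fact n)))). assert (PF : 0 <= F) by apply Cmod_ge_0.
  assert (P1 := proj1 (Cmod_gt_0 _) D1). assert (P2 := proj1 (Cmod_gt_0 _) D2).
  assert (R := Gamma_den_ratio M x1 x2 y n HM H1 H2 H12 Hy). simpl in R.
  set (d1 := Cmod (Gamma_den (x1, y) n)) in *. set (d2 := Cmod (Gamma_den (x2, y) n)) in *.
  assert (Pn : 1 <= INR n) by (apply (le_INR 1); lia).
  replace (Rpower (INR n) x1) with (Rpower (INR n) x2 * Rpower (INR n) (x1 - x2))
    by (rewrite <- Rpower_plus; f_equal; ring).
  apply Rle_div_l; auto.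
  replace (c * (F * Rpower (INR n) x2 / d2) * d1)
    with (F * Rpower (INR n) x2 * (c * d1 / d2)) by (field; lra).
  rewrite <- Rmult_assoc. apply Rmult_le_compat_l.
  { apply Rmult_le_pos; auto. left; apply Rpower_pos. }
  apply Rle_div_r; auto.
  apply Rle_trans with (Rpower (INR n) (x1 - x2) * (d1 * exp ((x1 - x2) * (ln (0 * (0 * 1) + y * (y * 1)) / 2
     - ln (INR (S n) * (INR (S n) * 1) + y * (y * 1)) / 2) + 128 * (M * (M * 1)) * (2 - / INR (S n))))).
  { apply Rmult_le_compat_l; [left; apply Rpower_pos|exact R]. }
  unfold c, Rpower.
  match goal with |- exp ?u * (d1 * exp ?v) <= exp ?p * exp ?q * d1 =>
    replace (exp u * (d1 * exp v)) with (d1 * exp (u + v)) by (rewrite exp_plus; ring);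
    replace (exp p * exp q * d1) with (d1 * exp (p + q)) by (rewrite exp_plus; ring)
  end.
  apply Rmult_le_compat_l; [lra|]. apply exp_le.
  assert (Hl0 : ln (0 * (0 * 1) + y * (y * 1)) / 2 = ln (Rabs y)).
  { replace (0 * (0 * 1) + y * (y * 1)) with (Rabs y * Rabs y)
      by (rewrite <- Rabs_mult, Rabs_pos_eq by nra; ring).
    rewrite ln_mult by lra. field. }
  (* The n^(x1 - x2) of Euler's limit is absorbed by the telescoped end term h(n+1) >= ln n, leaving
     a bound free of n. *)
  assert (Hln : ln (INR n) <= ln (INR (S n) * (INR (S n) * 1) + y * (y * 1)) / 2).
  { replace (ln (INR n)) with (ln (INR n * INR n) / 2)
      by (rewrite ln_mult by lra; field).
    apply Rmult_le_compat_r; [lra|]. apply ln_le; rewrite ?S_INR; nra. }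
  rewrite Hl0.
  assert (Pi : 0 < / INR (S n)) by (apply Rinv_0_lt_compat, lt_0_INR; lia).
  nra.
- now apply Cmod_lim.
- apply (is_lim_seq_scal_l _ c (Cmod (Gamma (x2, y)))). now apply Cmod_lim.
Qed.

(** * The Selberg class *)

(** With a(n) = O(n) the terms are O(n^-2) once Re s >= 3. *)
Lemma dirichlet_series_bounded (a : nat -> C) (L : C -> C) :
  dirichlet_series_of a L -> ramanujan_bound a ->
  exists K, 0 <= K /\ forall s, 3 <= Re s -> Cmod (L s) <= K.
Proof.
intros HL Ha. destruct (Ha 1 Rlt_0_1) as [K HK].
assert (PK : 0 <= K).
{ specialize (HK 1%nat (le_n _)). simpl in HK.
  rewrite Rpower_1 in HK by lra. generalize (Cmod_ge_0 (a 1%nat)); lra. }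
exists (K * 2); split; [lra|]. intros s Hs.
specialize (HL s ltac:(lra)).
set (u := fun n => (a (S n) * Rcpow (INR (S n)) (- s))%C) in HL.
assert (Hu : forall n, Cmod (u n) <= K * / INR (S n) ^ 2).
{ intros n. unfold u. rewrite Cmod_mult, Cmod_Rcpow, re_opp.
  assert (Pn : 1 <= INR (S n)) by (apply (le_INR 1); lia).
  apply Rle_trans with (K * Rpower (INR (S n)) 1 * Rpower (INR (S n)) (- (3))).
  - apply Rmult_le_compat; [apply Cmod_ge_0|left; apply Rpower_pos|apply HK; lia|].
    apply Rle_Rpower; lra.
  - rewrite Rmult_assoc, <- Rpower_plus. replace (1 + - (3)) with (- INR 2) by (simpl; ring).
    rewrite Rpower_Ropp, Rpower_pow by lra. lra. }
assert (Hsum : forall n, Cmod (@sum_n C_AbelianMonoid u n) <= K * (2 - / INR (S n))).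
{ induction n as [|n IH].
  - rewrite sum_O. eapply Rle_trans; [apply Hu|]. simpl. lra.
  - rewrite sum_Sn. eapply Rle_trans; [apply Cmod_triangle|].
    specialize (Hu (S n)). assert (T := inv_telescope (S n) ltac:(lia)). nra. }
assert (Hlim : is_lim_seq (fun n => Cmod (@sum_n C_AbelianMonoid u n)) (Cmod (L s))).
{ exact (filterlim_comp _ _ _ _ _ _ _ _ HL
    (@filterlim_norm C_AbsRing C_NormedModule (L s))). }
apply (is_lim_seq_le _ (fun _ => K * 2) _ (K * 2) ) with (2 := Hlim).
- intros n. eapply Rle_trans; [apply Hsum|].
  assert (0 < / INR (S n)) by (apply Rinv_0_lt_compat, lt_0_INR; lia). nra.
- apply is_lim_seq_const.
Qed.

Lemma Cmod_ge_Im_pow (s : C) (k : nat) :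
  0 < Rabs (Im s) -> Rpower (Rabs (Im s)) (INR k) <= Cmod ((s - RtoC 1) ^ k).
Proof.
intros Hs. rewrite Rpower_pow by auto. rewrite Cmod_pow.
apply pow_incr; split; [lra|].
replace (Im s) with (Im (s - RtoC 1)) by (destruct s; simpl; ring). apply im_le_Cmod.
Qed.

Lemma Cmod_le_Im_pow (s : C) (k : nat) :
  0 < Rabs (Im s) -> Rabs (Re s - 1) <= Rabs (Im s) ->
  Cmod ((s - RtoC 1) ^ k) <= 2 ^ k * Rpower (Rabs (Im s)) (INR k).
Proof.
intros Hs Hr. rewrite Rpower_pow by auto. rewrite Cmod_pow, <- Rpow_mult_distr.
apply pow_incr; split; [apply Cmod_ge_0|].
eapply Rle_trans; [apply Cmod_le_parts|].
replace (Re (s - RtoC 1)) with (Re s - 1) by (destruct s; simpl; ring).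
replace (Im (s - RtoC 1)) with (Im s) by (destruct s; simpl; ring). lra.
Qed.

Lemma Im_neq_0 (s : C) (r : R) : 0 < Rabs (Im s) -> s <> RtoC r.
Proof. intros H E. rewrite E, im_RtoC, Rabs_R0 in H. lra. Qed.

(** At large height |s - 1|^k is comparable to |t|^k, so passing from L to G raises the exponent by
    k on both edges and in between; the slope q is unchanged and the shift cancels at the end. *)
Theorem Phragmen_Lindelof_continuation (L : C -> C) (x0 x1 p q l : R) :
  analytic_continuation L -> x0 <= x1 <= x0 + 2 -> 0 <= l ->
  (exists K T, forall t, T <= Rabs t ->
     Cmod (L (x0, t)) <= K * (Rpower (Rabs t) p * Rpower (ln (Rabs t)) l)) ->
  (exists K T, forall t, T <= Rabs t ->
     Cmod (L (x1, t)) <= K * (Rpower (Rabs t) (p + q * (x1 - x0))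
                              * Rpower (ln (Rabs t)) l)) ->
  exists K T, forall s : C, T <= Rabs (Im s) -> x0 <= Re s <= x1 ->
    Cmod (L s) <= K * (Rpower (Rabs (Im s)) (p + q * (Re s - x0))
                       * Rpower (ln (Rabs (Im s))) l).
Proof.
intros [k [G [HG [Hord HGL]]]] Hx Hl H0 H1.
assert (edge : forall x e,
  (exists K T, forall t, T <= Rabs t ->
     Cmod (L (x, t)) <= K * (Rpower (Rabs t) e * Rpower (ln (Rabs t)) l)) ->
  exists K T, forall t, T <= Rabs t ->
     Cmod (G (x, t)) <= K * (Rpower (Rabs t) (INR k + e) * Rpower (ln (Rabs t)) l)).
{ intros x e [K [T HK]]. exists (2 ^ k * K), (Rabs T + Rabs (x - 1) + 1). intros t Ht.
  assert (PT := Rabs_pos T). assert (LT := Rle_abs T). assert (Px := Rabs_pos (x - 1)).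
  rewrite HGL by (apply Im_neq_0; simpl; lra).
  rewrite Cmod_mult.
  apply Rle_trans with (2 ^ k * Rpower (Rabs t) (INR k)
    * (K * (Rpower (Rabs t) e * Rpower (ln (Rabs t)) l))).
  - apply Rmult_le_compat; try apply Cmod_ge_0.
    + apply (Cmod_le_Im_pow (x, t)); simpl; lra.
    + apply HK; lra.
  - right. rewrite Rpower_plus. ring. }
destruct (Phragmen_Lindelof G x0 x1 (INR k + p) q l) as [K [T HK]]; auto.
- intros z. apply diff_at_ex_derive, HG.
- destruct (edge _ _ H1) as [K [T HK]]. exists K, T. intros t Ht.
  rewrite Rplus_assoc. auto.
- exists K, (Rabs T + 1). intros s Hs Hre.
  assert (PT := Rabs_pos T). assert (LT := Rle_abs T).
  specialize (HK s ltac:(lra) Hre).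
  rewrite HGL in HK by (apply Im_neq_0; lra).
  rewrite Cmod_mult, Rplus_assoc, Rpower_plus in HK.
  assert (Hk := Cmod_ge_Im_pow s k ltac:(lra)).
  assert (PR := Rpower_pos (Rabs (Im s)) (INR k)).
  apply Rmult_le_reg_l with (Rpower (Rabs (Im s)) (INR k)); auto.
  eapply Rle_trans; [apply Rmult_le_compat_r; [apply Cmod_ge_0|exact Hk]|].
  eapply Rle_trans; [exact HK|]. right; ring.
Qed.

(** Interpolation with exponent 0 on both edges of [1, 3]: the hypothesis gives the left edge, and
    on the right edge and beyond the boundedness of L is absorbed by log^l >= 1. *)
Lemma bound_right_of_one (L : C -> C) (l : R) :
  (exists a, dirichlet_series_of a L /\ ramanujan_bound a) ->
  analytic_continuation L -> 0 <= l ->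
  (exists K T, forall t, T <= Rabs t ->
     Cmod (L (1, t)) <= K * Rpower (ln (Rabs t)) l) ->
  exists K T, forall s, T <= Rabs (Im s) -> 1 <= Re s ->
    Cmod (L s) <= K * Rpower (ln (Rabs (Im s))) l.
Proof.
intros [a [Hda Hra]] HC Hl [K1 [T1 H1]].
destruct (dirichlet_series_bounded a L Hda Hra) as [K3 [PK3 H3]].
assert (Hlog : forall t, 3 <= t -> 1 <= Rpower (ln t) l).
{ intros t Ht. apply Rpower_ge_1; auto. now apply ln_ge_1. }
destruct (Phragmen_Lindelof_continuation L 1 3 0 0 l) as [K [T HK]]; auto; try lra.
- exists K1, (Rabs T1 + 1). intros t Ht.
  assert (PT := Rabs_pos T1). assert (LT := Rle_abs T1).
  rewrite Rpower_O, Rmult_1_l by lra. apply H1. lra.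
- exists K3, 3. intros t Ht. replace (0 + 0 * (3 - 1)) with 0 by ring.
  rewrite Rpower_O, Rmult_1_l by lra.
  apply Rle_trans with K3; [apply H3; simpl; lra|].
  specialize (Hlog (Rabs t) Ht). nra.
- exists (Rabs K + K3), (Rabs T + 3). intros s Hs Hre.
  assert (PT := Rabs_pos T). assert (LT := Rle_abs T).
  assert (PK := Rabs_pos K). assert (LK := Rle_abs K).
  specialize (Hlog (Rabs (Im s)) ltac:(lra)).
  destruct (Rle_or_lt (Re s) 3) as [H|H].
  + specialize (HK s ltac:(lra) ltac:(lra)).
    replace (0 + 0 * (Re s - 1)) with 0 in HK by ring.
    rewrite Rpower_O, Rmult_1_l in HK by lra. nra.
  + specialize (H3 s ltac:(lra)). nra.
Qed.

(** * Reflection through the functional equation *)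

(** The two arguments of each factor have the same imaginary part, and their real parts differ by
    lambda (1 - 2 Re s) >= 0, so [Gamma_ratio] applies; the exponents add up over the list. *)
Lemma Gamma_product_ratio (gf : list (R * C)) (sigma0 : R) : sigma0 <= 0 ->
  (forall lm, In lm gf -> 0 < fst lm) ->
  exists K T, 0 < K /\ forall s : C, T <= Rabs (Im s) -> sigma0 <= Re s <= 0 ->
    (forall lm, In lm gf -> Im (RtoC (fst lm) * s + snd lm) <> 0) /\
    Cmod (Cprod (map (fun lm =>
            Gamma (RtoC (fst lm) * (RtoC 1 - Cconj s) + snd lm)) gf))
    <= K * Rpower (Rabs (Im s)) (fold_right Rplus 0 (map fst gf) * (1 - 2 * Re s))
       * Cmod (Cprod (map (fun lm => Gamma (RtoC (fst lm) * s + snd lm)) gf)).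
Proof.
intros Hs0. induction gf as [|[lam mu] gf IH]; intros Hpos.
- exists 1, 1. split; [lra|]. intros s Hs _. split; [intros lm []|].
  simpl. rewrite Cmod_1, Rmult_0_l, Rpower_O by lra. lra.
- destruct IH as [K [T [PK HK]]]; [intros lm Hlm; apply Hpos; now right|].
  assert (Hlam := Hpos (lam, mu) (or_introl eq_refl)). simpl in Hlam.
  (* M bounds the real parts of both arguments throughout sigma0 <= Re s <= 0. *)
  set (M := 1 + lam * (1 - sigma0) + Rabs (Re mu)).
  assert (Pm := Rabs_pos (Re mu)). assert (Pim := Rabs_pos (Im mu)).
  assert (HM : 1 <= M) by (unfold M; nra).
  destruct (Gamma_ratio M HM) as [K' [PK' HK']].
  exists (K' * Rpower (lam + 1) (lam * (1 - 2 * sigma0)) * K).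
  (* The quotient by [lam] gives |lam t + Im mu| >= 2M; the summand |Im mu| gives the upper bound
     (lam + 1)|t|. *)
  exists (Rabs T + 1 + Rabs (Im mu) + (2 * M + Rabs (Im mu)) / lam).
  split; [repeat apply Rmult_lt_0_compat; auto; apply Rpower_pos|].
  intros s Hs Hre.
  assert (PT := Rabs_pos T). assert (LT := Rle_abs T).
  assert (Pd : 0 < (2 * M + Rabs (Im mu)) / lam) by (apply Rdiv_lt_0_compat; lra).
  destruct (HK s ltac:(lra) Hre) as [Hne HKs].
  set (t := Im s) in *. set (sg := Re s) in *.
  assert (Ht : (2 * M + Rabs (Im mu)) / lam <= Rabs t) by lra.
  apply Rle_div_l in Ht; auto.
  set (y := lam * t + Im mu).
  assert (Hy1 : 2 * M <= Rabs y).
  { assert (H := Rabs_triang y (- Im mu)). rewrite Rabs_Ropp in H.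
    replace (y + - Im mu) with (lam * t) in H by (unfold y; ring).
    rewrite Rabs_mult, (Rabs_pos_eq lam) in H by lra. lra. }
  assert (Hy2 : Rabs y <= (lam + 1) * Rabs t).
  { unfold y. eapply Rle_trans; [apply Rabs_triang|].
    rewrite Rabs_mult, (Rabs_pos_eq lam) by lra. lra. }
  assert (E2 : (RtoC lam * s + mu)%C = (lam * sg + Re mu, y)).
  { apply injective_projections; unfold y, sg, t; destruct s, mu; simpl; ring. }
  assert (E1 : (RtoC lam * (RtoC 1 - Cconj s) + mu)%C = (lam * (1 - sg) + Re mu, y)).
  { apply injective_projections; unfold y, sg, t; destruct s, mu; simpl; ring. }
  split.
  + intros lm [<-|Hlm]; [|now apply Hne]. cbn [fst snd].
    rewrite E2. simpl. intros E. rewrite E, Rabs_R0 in Hy1. lra.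
  + cbn [map Cprod fold_right fst snd]. rewrite !Cmod_mult, E1, E2.
    fold (Cprod (map (fun lm => Gamma (RtoC (fst lm) * (RtoC 1 - Cconj s) + snd lm)%C) gf)).
    fold (Cprod (map (fun lm => Gamma (RtoC (fst lm) * s + snd lm)%C) gf)).
    set (g1 := Cmod (Gamma (lam * (1 - sg) + Re mu, y))).
    set (g2 := Cmod (Gamma (lam * sg + Re mu, y))).
    set (S := fold_right Rplus 0 (map fst gf)) in *.
    assert (Pg2 : 0 <= g2) by apply Cmod_ge_0.
    assert (Lmu : - Rabs (Re mu) <= Re mu <= Rabs (Re mu)) by now apply Rabs_le_between.
    assert (Hg : g1 <= K' * Rpower (lam + 1) (lam * (1 - 2 * sigma0))
                       * Rpower (Rabs t) (lam * (1 - 2 * sg)) * g2).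
    { eapply Rle_trans; [apply (HK' _ (lam * sg + Re mu)); auto;
        try (apply Rabs_le; unfold M; nra); nra|].
      replace (lam * (1 - sg) + Re mu - (lam * sg + Re mu))
        with (lam * (1 - 2 * sg)) by ring.
      apply Rmult_le_compat_r; auto. rewrite Rmult_assoc.
      apply Rmult_le_compat_l; [lra|].
      assert (He : 0 <= lam * (1 - 2 * sg)) by nra.
      apply Rle_trans with (Rpower ((lam + 1) * Rabs t) (lam * (1 - 2 * sg))).
      - apply Rle_Rpower_l; auto. lra.
      - rewrite <- Rpower_mult_distr by lra. apply Rmult_le_compat_r; [left; apply Rpower_pos|].
        apply Rle_Rpower; [lra|]. nra. }
    eapply Rle_trans; [apply Rmult_le_compat; [apply Cmod_ge_0|apply Cmod_ge_0|exact Hg|exact HKs]|].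
    right. rewrite Rmult_plus_distr_r, Rpower_plus. ring.
Qed.

Lemma Gamma_pole_Im (z : C) : Gamma_pole z -> Im z = 0.
Proof. intros [n ->]. apply im_RtoC. Qed.

Lemma Cprod_Gamma_neq_0 (A : Type) (f : A -> C) (k : list A) :
  (forall x, In x k -> Im (f x) <> 0) -> Cprod (map (fun x => Gamma (f x)) k) <> RtoC 0.
Proof.
induction k as [|x k IH]; intros H; simpl.
- intros E. apply RtoC_inj in E. lra.
- apply Cmult_neq_0; [|apply IH; intros; apply H; now right].
  apply Gamma_approx_cv. apply H. now left.
Qed.

(** In the modulus of the functional equation, 1 - conj s has real part at least 1 and the same
    height as s, so L there is O(log^l); the rest is the Gamma quotient and Q^(1 - 2 Re s). *)
Lemma bound_left_of_zero (L : C -> C) (Q sigma0 l : R) (omega : C) (gf : list (R * C)) :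
  functional_equation L Q omega gf -> sigma0 <= 0 ->
  (exists K T, forall s, T <= Rabs (Im s) -> 1 <= Re s ->
     Cmod (L s) <= K * Rpower (ln (Rabs (Im s))) l) ->
  exists K T, forall s, T <= Rabs (Im s) -> sigma0 <= Re s <= 0 ->
    Cmod (L s) <= K * (Rpower (Rabs (Im s))
                         (fold_right Rplus 0 (map fst gf) * (1 - 2 * Re s))
                       * Rpower (ln (Rabs (Im s))) l).
Proof.
intros [HQ [Hom [Hgf HFE]]] Hs0 [K1 [T1 H1]].
destruct (Gamma_product_ratio gf sigma0 Hs0) as [K2 [T2 [PK2 H2]]].
{ intros lm Hlm. now apply Hgf. }
(* Bounds Q^(1 - 2 Re s) on the whole strip, whether Q is above or below 1. *)
set (q := exp (Rabs (ln Q) * (1 - 2 * sigma0))).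
exists (Rabs K1 * q * K2), (Rabs T1 + Rabs T2 + 1).
intros s Hs Hre.
assert (PT1 := Rabs_pos T1). assert (LT1 := Rle_abs T1).
assert (PT2 := Rabs_pos T2). assert (LT2 := Rle_abs T2).
assert (PK := Rabs_pos K1). assert (LK := Rle_abs K1).
destruct (H2 s ltac:(lra) Hre) as [Hne HG].
assert (Him : Im (RtoC 1 - Cconj s) = Im s) by (destruct s; simpl; ring).
assert (Hre' : Re (RtoC 1 - Cconj s) = 1 - Re s) by (destruct s; simpl; ring).
specialize (HFE s ltac:(apply Im_neq_0; lra) ltac:(apply Im_neq_0; lra)).
assert (FE : Lambda L Q gf s = (omega * Cconj (Lambda L Q gf (RtoC 1 - Cconj s)))%C).
{ apply HFE. intros lm Hlm. specialize (Hne lm Hlm).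
  split; intros Hp; apply Gamma_pole_Im in Hp; apply Hne; auto.
  rewrite <- Hp. rewrite !im_plus, !im_scal_l, Him. reflexivity. }
apply (f_equal Cmod) in FE. rewrite Cmod_mult, Cmod_conj, Hom, Rmult_1_l in FE.
unfold Lambda in FE. rewrite !Cmod_mult, !Cmod_Rcpow, Hre' in FE.
assert (N2 := Cprod_Gamma_neq_0 _ (fun lm => RtoC (fst lm) * s + snd lm)%C gf Hne).
apply Cmod_gt_0 in N2.
set (G1 := Cmod (Cprod (map (fun lm => Gamma (RtoC (fst lm) * (RtoC 1 - Cconj s) + snd lm)%C) gf))) in *.
set (G2 := Cmod (Cprod (map (fun lm => Gamma (RtoC (fst lm) * s + snd lm)%C) gf))) in *.
set (S := Rpower (Rabs (Im s)) (fold_right Rplus 0 (map fst gf) * (1 - 2 * Re s))) in *.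
assert (HL1 : Cmod (L (RtoC 1 - Cconj s)%C) <= Rabs K1 * Rpower (ln (Rabs (Im s))) l).
{ rewrite <- Him. eapply Rle_trans; [apply H1; rewrite ?Him, ?Hre'; lra|].
  apply Rmult_le_compat_r; [left; apply Rpower_pos|auto]. }
set (lg := Rpower (ln (Rabs (Im s))) l) in *.
assert (Hq : Rpower Q (1 - Re s) <= q * Rpower Q (Re s)).
{ unfold q, Rpower. rewrite <- exp_plus. apply exp_le.
  assert (L1 := Rle_abs (ln Q)). assert (L2 := Rabs_pos (ln Q)). nra. }
assert (PQ := Rpower_pos Q (Re s)).
apply Rmult_le_reg_r with (Rpower Q (Re s) * G2); [now apply Rmult_lt_0_compat|].
rewrite <- Rmult_assoc, FE.
apply Rle_trans with (Rabs K1 * lg * (q * Rpower Q (Re s)) * (K2 * S * G2)).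
- apply Rmult_le_compat3; auto; try apply Cmod_ge_0. left; apply Rpower_pos.
- right; ring.
Qed.

Theorem proposition1 (sigma0 : R) (L : C -> C) (d l : R)
  (hsigma0 : sigma0 < 0)
  (hL : selberg_class L)
  (hd : has_degree L d)
  (hl : 0 < l)
  (hline : exists K T : R, forall t : R, T <= Rabs t ->
     Cmod (L (1, t)) <= K * Rpower (ln (Rabs t)) l) :
  exists K T : R, forall s : C, T <= Rabs (Im s) ->
    (sigma0 <= Re s < 0 ->
       Cmod (L s) <= K * (Rpower (Rabs (Im s)) (d * (1 / 2 - Re s))
                          * Rpower (ln (Rabs (Im s))) l)) /\
    (0 <= Re s <= 1 ->
       Cmod (L s) <= K * (Rpower (Rabs (Im s)) (1 / 2 * d * (1 - Re s))
                          * Rpower (ln (Rabs (Im s))) l)) /\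
    (1 < Re s ->
       Cmod (L s) <= K * Rpower (ln (Rabs (Im s))) l).
Proof.
destruct hL as [HD [HC _]].
(* The functional equation is the one that witnesses the degree, so that the sum S of its lambda_j
   is d/2. *)
destruct hd as [Q [omega [gf [HFE Hd]]]].
set (S := fold_right Rplus 0 (map fst gf)) in *.
assert (HR := bound_right_of_one L l HD HC ltac:(lra) hline).
assert (HLft := bound_left_of_zero L Q sigma0 l omega gf HFE ltac:(lra) HR).
fold S in HLft.
destruct HR as [K1 [T1 H1]]. destruct HLft as [K2 [T2 H2]].
(* The exponent falls linearly from d/2 on Re s = 0, an edge covered by the left-hand bound, to 0 on
   Re s = 1. *)
destruct (Phragmen_Lindelof_continuation L 0 1 (1 / 2 * d) (- (1 / 2 * d)) l)
  as [K3 [T3 H3]]; auto; try lra.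
{ exists K2, T2. intros t Ht. specialize (H2 (0, t) Ht). simpl in H2.
  replace (1 / 2 * d) with (S * (1 - 2 * 0)) by lra. apply H2. lra. }
{ exists K1, (Rabs T1 + 1). intros t Ht.
  assert (PT := Rabs_pos T1). assert (LT := Rle_abs T1).
  replace (1 / 2 * d + - (1 / 2 * d) * (1 - 0)) with 0 by ring.
  rewrite Rpower_O, Rmult_1_l by lra. apply (H1 (1, t)); simpl; lra. }
assert (PT1 := Rabs_pos T1). assert (LT1 := Rle_abs T1).
assert (PT2 := Rabs_pos T2). assert (LT2 := Rle_abs T2).
assert (PT3 := Rabs_pos T3). assert (LT3 := Rle_abs T3).
assert (PK1 := Rabs_pos K1). assert (LK1 := Rle_abs K1).
assert (PK2 := Rabs_pos K2). assert (LK2 := Rle_abs K2).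
assert (PK3 := Rabs_pos K3). assert (LK3 := Rle_abs K3).
exists (Rabs K1 + Rabs K2 + Rabs K3), (Rabs T1 + Rabs T2 + Rabs T3).
intros s Hs.
assert (Pl := Rpower_pos (ln (Rabs (Im s))) l).
split; [|split]; intros Hre.
- eapply Rle_trans; [apply H2; lra|].
  replace (S * (1 - 2 * Re s)) with (d * (1 / 2 - Re s)) by (rewrite Hd; field).
  apply Rmult_le_compat_r; [|lra].
  left; apply Rmult_lt_0_compat; auto; apply Rpower_pos.
- eapply Rle_trans; [apply H3; lra|].
  replace (1 / 2 * d + - (1 / 2 * d) * (Re s - 0)) with (1 / 2 * d * (1 - Re s)) by ring.
  apply Rmult_le_compat_r; [|lra].
  left; apply Rmult_lt_0_compat; auto; apply Rpower_pos.
- eapply Rle_trans; [apply H1; lra|].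
  apply Rmult_le_compat_r; lra.
Qed.
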